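(* Let $f$ be a regulated function on $[a,b]$ having the quadratic $\lambda$-variation for some $\lambda\in\Lambda[a,b]$ such that $\{t\in(a,b):\Delta^-f(t)\,\Delta^+f(t)\ne0\}\subset\cup\lambda$. If also $\Delta^-f(x)\ne-1\ne\Delta^+f(y)$ for all $a\le y<x\le b$, then the product $\lambda$-integral $\prod(1+d_\lambda f)$ is defined on $[a,b]$ and equals $\beta_\lambda(f)$, that is, $\prod_u^v(1+d_\lambda f)=\beta_\lambda(f;u,v)$ for all $(u,v)\in S[\![a,b]\!]$.
   Context: Fix real $a<b$. A function $f:[a,b]\to\mathbb R$ is regulated if the finite limits $f(t-)$, $t\in(a,b]$, and $f(s+)$, $s\in[a,b)$, exist; $\Delta^-f(t)=f(t)-f(t-)$ and $\Delta^+f(s)=f(s+)-f(s)$. $\Lambda[a,b]$ is the set of sequences $\lambda=\{\lambda_m:m\ge1\}$ of partitions (finite sets $a=t_0<\dots<t_n=b$) of $[a,b]$ with $\lambda_m\subset\lambda_{m+1}$ and $\cup\lambda:=\bigcup_m\lambda_m$ dense in $[a,b]$. For $a\le s<t\le b$ let $\lambda_m|_{[s,t]}=\{s,t\}\cup(\lambda_m\cap(s,t))=\{s=x_0<\dots<x_n=t\}$. A regulated $f$ has the quadratic $\lambda$-variation on $[a,b]$ if there is a regulated $V$ with $V(a)=0$ and, for all $a\le s<t\le b$, $V(t)-V(s)=\lim_{m\to\infty}\sum_i[f(x_i)-f(x_{i-1})]^2$ (sum over $\lambda_m|_{[s,t]}$), $\Delta^-V(t)=(\Delta^-f(t))^2$,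 $\Delta^+V(s)=(\Delta^+f(s))^2$. Then $[f]_\lambda:=V$ and $[f]^c_\lambda(t)=[f]_\lambda(t)-\sum_{(a,t]}(\Delta^-f)^2-\sum_{[a,t)}(\Delta^+f)^2$ (a continuous nondecreasing function). Extended interval: $[\![a,b]\!]$ consists of the points of $[a,b]$ together with the symbols $t-$ ($a<t\le b$) and $t+$ ($a\le t<b$), linearly ordered by $z+<x-<x<x+<y-$ for $z<x<y$; $S[\![a,b]\!]=\{(u,v):u,v\in[\![a,b]\!],\,u\le v\}$. Regulated functions are extended to $[\![a,b]\!]$ by their one-sided limits. Product $\lambda$-integral: it is defined on $[a,b]$ if there is a regulated function $G$ on $[a,b]$ with $G(a)=1$, $\inf|G|>0$ and, for all $a\le s<t\le b$, $G(t)/G(s)=\lim_{m\to\infty}\prod_i[1+f(x_i)-f(x_{i-1})]$ (product over $\lambda_m|_{[s,t]}$), $G(t)/G(t-)=1+\Delta^-f(t)$, $G(s+)/G(s)=1+\Delta^+f(s)$; then $\prod_u^v(1+d_\lambda f):=G(v)/G(u)$ for $(u,v)\in S[\![a,b]\!]$. The function $\beta_\lambda(f)$: for $(u,v)\in S[\![a,b]\!]$, $$\beta_\lambda(f;u,v)=\exp\Big\{f(v)-f(u)-\tfrac12\big([f]^c_\lambda(v)-[f]^c_\lambda(u)\big)\Big\}\,\gamma(f;u,v),$$ where $\gamma(f;u,u)=1$ and, for $u<v$, $$\gamma(f;u,v)=\lim_{\delta\downarrow0}\ \prod_{\substack{x\in(a,b],\ u<x\le v\\ |\Delta^-f(x)|>\delta}}(1+\Delta^-f(x))e^{-\Delta^-f(x)}\prod_{\substack{x\in[a,b),\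 u\le x<v\\ |\Delta^+f(x)|>\delta}}(1+\Delta^+f(x))e^{-\Delta^+f(x)},$$ an absolutely convergent infinite product (inequalities between $x,u,v$ are in the order of $[\![a,b]\!]$). *)

(* Defs.v *)
From HB Require Import structures.
From mathcomp Require Export all_boot all_order all_algebra.
From mathcomp Require Export all_classical all_reals all_analysis.
Export Order.TTheory GRing.Theory Num.Theory.
Export numFieldNormedType.Exports.

Set Implicit Arguments.
Unset Strict Implicit.
Unset Printing Implicit Defensive.

Local Open Scope classical_set_scope.
Local Open Scope ring_scope.

(* A function on [a, b] is represented by a function f : R -> R of which only
   the values on [a, b] matter: the left limit is only taken at points of
   ]a, b] and the right limit at points of [a, b[. *)

Definition llim (R : realType) (f : R -> R) (t : R) : R :=
  lim (f x @[x --> t^'-]).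

Definition rlim (R : realType) (f : R -> R) (s : R) : R :=
  lim (f x @[x --> s^'+]).

Definition regulated (R : realType) (a b : R) (f : R -> R) : Prop :=
  (forall t, t \in `]a, b] -> cvg (f x @[x --> t^'-])) /\
  (forall s, s \in `[a, b[ -> cvg (f x @[x --> s^'+])).

Definition ljump (R : realType) (f : R -> R) (t : R) : R := f t - llim f t.

Definition rjump (R : realType) (f : R -> R) (s : R) : R := rlim f s - f s.

(* As in the library's itv_partition, the partition a = t_0 < ... < t_n = b is
   encoded by the list [:: t_1; ...; t_n], the left end point being kept
   separately, so that its set of points is a :: p. *)

Definition nested_partitions (R : realType) (a b : R) (lam : nat -> seq R)
    : Prop :=
  [/\ forall m, itv_partition a b (lam m),
      forall m, {subset a :: lam m <= a :: lam m.+1}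
    & `[a, b] `<=` closure (\bigcup_m [set` a :: lam m])].

Definition partition_restr (R : realType) (p : seq R) (s t : R) : seq R :=
  rcons [seq x <- p | s < x < t] t.

Definition square_sum (R : realType) (f : R -> R) (s : R) (p : seq R) : R :=
  let F := f \o nth s (s :: p) in
  \sum_(0 <= i < size p) (F i.+1 - F i) ^+ 2.

Definition incr_prod (R : realType) (f : R -> R) (s : R) (p : seq R) : R :=
  let F := f \o nth s (s :: p) in
  \prod_(0 <= i < size p) (1 + (F i.+1 - F i)).

Definition is_quad_variation (R : realType) (a b : R) (lam : nat -> seq R)
    (f V : R -> R) : Prop :=
  [/\ regulated a b V, V a = 0
    & forall s t, a <= s -> s < t -> t <= b ->
      [/\ square_sum f s (partition_restr (lam m) s t) @[m --> \oo]
            --> V t - V s,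
          ljump V t = ljump f t ^+ 2
        & rjump V s = rjump f s ^+ 2]].

Definition has_quad_variation (R : realType) (a b : R) (lam : nat -> seq R)
    (f : R -> R) : Prop :=
  exists V : R -> R, is_quad_variation a b lam f V.

(* is_quad_variation determines V on [a, b] (take s = a). *)
Definition quad_variation (R : realType) (a b : R) (lam : nat -> seq R)
    (f : R -> R) : R -> R :=
  xget (fun=> 0) [set V | is_quad_variation a b lam f V].

(* The unordered sums of nonnegative terms are taken in \bar R; they are finite
   when f has the quadratic variation. *)
Definition cont_quad_variation (R : realType) (a b : R) (lam : nat -> seq R)
    (f : R -> R) (t : R) : R :=
  quad_variation a b lam f t
  - fine (\esum_(x in `]a, t]) (ljump f x ^+ 2)%:E)
  - fine (\esum_(x in `[a, t[) (rjump f x ^+ 2)%:E).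

(* LPt t, Pt t and RPt t stand for t-, t and t+ respectively. *)
Inductive ext_point (R : Type) : Type :=
  | LPt of R
  | Pt of R
  | RPt of R.

Definition in_ext (R : realType) (a b : R) (u : ext_point R) : bool :=
  match u with
  | LPt t => a < t <= b
  | Pt t => a <= t <= b
  | RPt t => a <= t < b
  end.

Definition ext_base (R : Type) (u : ext_point R) : R :=
  match u with LPt t | Pt t | RPt t => t end.

Definition ext_side (R : Type) (u : ext_point R) : nat :=
  match u with LPt _ => 0 | Pt _ => 1 | RPt _ => 2 end.

Definition ext_lt (R : realType) (u v : ext_point R) : bool :=
  (ext_base u < ext_base v) ||
  ((ext_base u == ext_base v) && (ext_side u < ext_side v)%N).

Definition ext_le (R : realType) (u v : ext_point R) : bool :=
  (ext_base u < ext_base v) ||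
  ((ext_base u == ext_base v) && (ext_side u <= ext_side v)%N).

Definition ext_fun (R : realType) (f : R -> R) (u : ext_point R) : R :=
  match u with
  | LPt t => llim f t
  | Pt t => f t
  | RPt t => rlim f t
  end.

Definition is_prod_integral (R : realType) (a b : R) (lam : nat -> seq R)
    (f G : R -> R) : Prop :=
  [/\ regulated a b G, G a = 1, 0 < inf [set `|G x| | x in `[a, b]]
    & forall s t, a <= s -> s < t -> t <= b ->
      [/\ incr_prod f s (partition_restr (lam m) s t) @[m --> \oo]
            --> G t / G s,
          G t / llim G t = 1 + ljump f t
        & rlim G s / G s = 1 + rjump f s]].

Definition prod_integral_defined (R : realType) (a b : R) (lam : nat -> seq R)
    (f : R -> R) : Prop :=
  exists G : R -> R, is_prod_integral a b lam f G.

(* is_prod_integral determines G on [a, b] (take s = a). *)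
Definition prod_integral (R : realType) (a b : R) (lam : nat -> seq R)
    (f : R -> R) (u v : ext_point R) : R :=
  let G := xget (fun=> 1) [set G | is_prod_integral a b lam f G] in
  ext_fun G v / ext_fun G u.

(* For regulated f and d > 0 both index sets are finite; \big[_/_]_(x \in A)
   is the iterated operation over a finite classical set. *)
Definition gamma_partial (R : realType) (a b : R) (f : R -> R)
    (u v : ext_point R) (d : R) : R :=
  (\big[*%R/1]_(x \in [set x | [&& x \in `]a, b], ext_lt u (Pt x),
                                   ext_le (Pt x) v & d < `|ljump f x|]])
     ((1 + ljump f x) * expR (- ljump f x))) *
  (\big[*%R/1]_(x \in [set x | [&& x \in `[a, b[, ext_le u (Pt x),
                                   ext_lt (Pt x) v & d < `|rjump f x|]])
     ((1 + rjump f x) * expR (- rjump f x))).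

(* Only used for u <= v, so the second branch is the case u = v. *)
Definition gamma_prod (R : realType) (a b : R) (f : R -> R)
    (u v : ext_point R) : R :=
  if ext_lt u v then lim (gamma_partial a b f u v d @[d --> 0^'+]) else 1.

Definition beta (R : realType) (a b : R) (lam : nat -> seq R) (f : R -> R)
    (u v : ext_point R) : R :=
  let qc := cont_quad_variation a b lam f in
  expR (ext_fun f v - ext_fun f u - 2^-1 * (ext_fun qc v - ext_fun qc u))
  * gamma_prod a b f u v.

(* Main.v *)
Require Import Defs.
From mathcomp Require Import ring lra.

(** Let V be the quadratic variation of f, and let J(u, v) be the sum of the
    squares of the jumps of f in the extended interval [u, v]. With
    [beta_incr u v] = exp(df - (dV - J) / 2) * prod (1 + j) exp(- j), the product
    being over the jumps j in [u, v], the function G x = beta(a, x) is shown to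
    be the product integral.

    beta makes sense because V is nondecreasing with jumps j ^ 2: the squares of
    the jumps are summable ([jump_sq_le]), all but finitely many factors lie in
    (0, 1] and are exp(- j ^ 2 / 2) up to a third-order error, so the product
    converges to a nonzero limit ([jump_prod_cvg_neq0]). By construction beta is
    multiplicative ([beta_incrM]), equals 1 + j over a single jump
    ([beta_incr_gap]), and where all jumps are at most eta it is
    exp(df - dV / 2) up to a factor exp(+- 2 eta dV) ([beta_incr_bounds]): the
    subtraction of J and the product over small jumps compensate.

    For the limit of the partition products, compare them with G(t) / G(s). On
    an interval whose interior has oscillation at most eta, the first and the
    last factors converge to 1 + j for the jumps at the end points, and the
    expansion ln (1 + d) = d - d ^ 2 / 2 + O(eta d ^ 2) of the other factors
    gives exp(df - dV / 2) up to exp(+- O(eta dV)), because the square sums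
    converge to dV ([agree_small_osc]). Both the product and the error bound are
    compatible with concatenation of intervals ([partition_prod_cat]); at a point
    missing from all partitions this uses that at most one of the two jumps
    there is nonzero. Since a regulated function has small oscillation on
    one-sided neighbourhoods of every point, a supremum argument
    ([segment_induction]) extends the estimate to all intervals ([agree_near]),
    and eta tends to 0 ([partition_prod_cvg]). No partition points have to be matched
    with big jumps along the way. *)

Set Implicit Arguments.
Unset Strict Implicit.
Unset Printing Implicit Defensive.

Local Open Scope classical_set_scope.
Local Open Scope ring_scope.

(** * A second-order estimate of the logarithm *)

Section log_bounds.
Context {R : realType}.
Implicit Types x K eta : R.

(* h K x = (1 + x) exp(-(x - x^2/2 + K x^3)), whose derivative has the sign of
   1 - 3 K (1 + x): it is nondecreasing for K = 0 and, as soon as x >= -1/2,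
   nonincreasing for K = 2/3. *)
Let h K x := (1 + x) * expR (- x + 2^-1 * x ^+ 2 - K * x ^+ 3).

#[local] Instance is_derive_h K x :
  is_derive x 1 (h K) (x ^+ 2 * (1 - 3 * K * (1 + x)) *
                       expR (- x + 2^-1 * x ^+ 2 - K * x ^+ 3)).
Proof.
rewrite /h; apply: is_derive_eq.
rewrite /GRing.scale /=; set E := expR _.
by field.
Qed.

Let h_cont K (A : set R) : {within A, continuous (h K)}.
Proof.
apply: continuous_subspaceT => x; apply: differentiable_continuous.
by apply/derivable1_diffP; apply: ex_derive.
Qed.

Let hK0 K : h K 0 = 1.
Proof. by rewrite /h !expr0n /= !mulr0 oppr0 !addr0 expR0 mulr1. Qed.

Let h0_homo x y : x <= y -> h 0 x <= h 0 y.
Proof.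
move=> xy; apply: (@ger0_derive1_le_cc _ (h 0) x y) => //.
- move=> z _; rewrite derive1E derive_val mulr_ge0 ?expR_ge0//.
  by rewrite mulr_ge0 ?sqr_ge0//; lra.
- by rewrite in_itv /= lexx.
- by rewrite in_itv /= lexx andbT.
Qed.

Let h23_nhomo x y : - 2^-1 <= x -> x <= y -> h (2 / 3) y <= h (2 / 3) x.
Proof.
move=> x2 xy; apply: (@ler0_derive1_le_cc _ (h (2 / 3)) x y) => //.
- move=> z; rewrite in_itv /= => /andP[xz _].
  rewrite derive1E derive_val mulr_le0_ge0 ?expR_ge0// mulr_ge0_le0 ?sqr_ge0//.
  have : - 2^-1 <= z by rewrite (le_trans x2) ?ltW.
  lra.
- by rewrite in_itv /= lexx andbT.
- by rewrite in_itv /= lexx.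
Qed.

(** The second-order expansion of ln (1 + x), exponentiated so that products of
    such bounds are exponentials of sums; the cubic error is absorbed in
    eta * x ^+ 2 because the increments are uniformly small. *)
Lemma expR_quad_bounds x eta : `|x| <= eta -> eta <= 2^-1 ->
  expR (x - 2^-1 * x ^+ 2 - eta * x ^+ 2) <= 1 + x
    <= expR (x - 2^-1 * x ^+ 2 + eta * x ^+ 2).
Proof.
move=> xe e2; have := xe; rewrite ler_norml => /andP[xl xu].
have x2 : - 2^-1 <= x by lra.
have sq0 : 0 <= x ^+ 2 by exact: sqr_ge0.
have cub : x ^+ 3 = x ^+ 2 * x by rewrite exprSr.
have hE K c : (h K x <= 1 -> - x + 2^-1 * x ^+ 2 - K * x ^+ 3 >= - c ->
               1 + x <= expR c).
  move=> hx cK; have : 1 + x <= expR (x - 2^-1 * x ^+ 2 + K * x ^+ 3).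
    rewrite -[leRHS]mul1r -(opprK (x - _ + _)) expRN ler_pdivlMr ?expR_gt0//.
    by move: hx; rewrite /h; congr (_ * expR _ <= _); ring.
  by move/le_trans; apply; rewrite ler_expR; lra.
have hE' K c : (1 <= h K x -> - x + 2^-1 * x ^+ 2 - K * x ^+ 3 <= - c ->
               expR c <= 1 + x).
  move=> hx cK; have : expR (x - 2^-1 * x ^+ 2 + K * x ^+ 3) <= 1 + x.
    rewrite -[leLHS]mul1r -(opprK (x - _ + _)) expRN ler_pdivrMr ?expR_gt0//.
    by move: hx; rewrite /h; congr (_ <= _ * expR _); ring.
  by apply: le_trans; rewrite ler_expR; lra.
have [x0|/ltW x0] := leP 0 x; apply/andP; split.
- apply: (hE' 0); first by rewrite -(hK0 0) h0_homo.
  nra.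
- apply: (hE (2 / 3)).
    by have := @h23_nhomo 0 x; rewrite hK0; apply=> //; lra.
  rewrite cub; nra.
- apply: (hE' (2 / 3)).
    by have := @h23_nhomo x 0; rewrite hK0; apply.
  rewrite cub; nra.
- apply: (hE 0); first by rewrite -(hK0 0) h0_homo.
  nra.
Qed.

End log_bounds.

(** * The extended interval and its gaps *)

Section ext_order.
Context {R : realType}.
Implicit Types (u v w : ext_point R) (x : R).

Lemma ext_le_refl u : ext_le u u.
Proof. by rewrite /ext_le eqxx leqnn orbT. Qed.

Lemma ext_le_trans v u w : ext_le u v -> ext_le v w -> ext_le u w.
Proof.
rewrite /ext_le => /orP[uv|/andP[/eqP uv suv]] /orP[vw|/andP[/eqP vw svw]].
- by rewrite (lt_trans uv vw).
- by rewrite -vw uv.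
- by rewrite uv vw.
- by rewrite uv vw eqxx (leq_trans suv svw) orbT.
Qed.

Lemma ext_ltNge u v : ext_lt u v = ~~ ext_le v u.
Proof.
rewrite /ext_lt /ext_le negb_or negb_and -leNgt -ltnNge.
by case: (ltgtP (ext_base u) (ext_base v)).
Qed.

Lemma ext_lt_le u v : ext_lt u v -> ext_le u v.
Proof.
by rewrite /ext_lt /ext_le => /orP[->//|/andP[-> /ltnW ->]]; rewrite orbT.
Qed.

Lemma ext_le_anti u v : ext_le u v -> ext_le v u -> u = v.
Proof.
rewrite /ext_le; case: (ltgtP (ext_base u) (ext_base v)) => //= e uv vu.
have : ext_side u = ext_side v by apply/eqP; rewrite eqn_leq uv.
by move: e; case: u {uv vu} => ?; case: v => ? //= ->.
Qed.

(** The jumps of a function at x are its increments over the two gaps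
    (x-, x) and (x, x+) of the extended line; [side] selects the gap. *)
Definition gap_lo (side : bool) x := if side then Pt x else LPt x.
Definition gap_hi (side : bool) x := if side then RPt x else Pt x.

Lemma gap_lt side x : ext_lt (gap_lo side x) (gap_hi side x).
Proof. by case: side; rewrite /ext_lt /= eqxx orbT. Qed.

Lemma gap_le side x : ext_le (gap_lo side x) (gap_hi side x).
Proof. by rewrite ext_lt_le// gap_lt. Qed.

(** A gap contains no extended point, so every extended point lies on one side
    of it; this is what makes the sums and products over gaps additive and
    multiplicative in the interval. *)
Lemma gap_cut side x w : ext_le w (gap_lo side x) = ~~ ext_le (gap_hi side x) w.
Proof.
rewrite -ext_ltNge /ext_le /ext_lt.
by case: side w => [] [] y /=; case: (ltgtP y x).
Qed.

Lemma gap_hi_lo side x y : ext_le (gap_hi side x) (gap_lo side y) = (x < y).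
Proof. by rewrite /ext_le; case: side => /=; case: (ltgtP x y). Qed.

End ext_order.

Section ext_monotone.
Context {R : realType} (a b : R) (V : R -> R).
Hypothesis regV : regulated a b V.
Hypothesis V_le : forall x y, a <= x -> x < y -> y <= b -> V x <= V y.

Lemma llim_ge x t : a <= x -> x < t -> t <= b -> V x <= llim V t.
Proof.
move=> ax xt tb; apply: limr_ge.
  by apply: regV.1; rewrite in_itv /= tb (le_lt_trans ax xt).
near=> y; have yt : y < t by near: y; exact: nbhs_left_lt.
have xy : x < y by near: y; exact: nbhs_left_gt.
by apply: V_le => //; rewrite (le_trans (ltW yt)).
Unshelve. all: by end_near. Qed.

Lemma llim_le t : a < t -> t <= b -> llim V t <= V t.
Proof.
move=> lat tb; apply: limr_le.
  by apply: regV.1; rewrite in_itv /= tb lat.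
near=> y; have yt : y < t by near: y; exact: nbhs_left_lt.
have ay : a < y by near: y; exact: nbhs_left_gt.
by apply: V_le => //; exact: ltW.
Unshelve. all: by end_near. Qed.

Lemma rlim_le t y : a <= t -> t < y -> y <= b -> rlim V t <= V y.
Proof.
move=> lat ty yb; apply: limr_le.
  by apply: regV.2; rewrite in_itv /= lat (lt_le_trans ty yb).
near=> z; have tz : t < z by near: z; exact: nbhs_right_gt.
have zy : z < y by near: z; exact: nbhs_right_lt.
by apply: V_le => //; rewrite (le_trans lat) ?ltW.
Unshelve. all: by end_near. Qed.

Lemma rlim_ge t : a <= t -> t < b -> V t <= rlim V t.
Proof.
move=> lat tb; apply: limr_ge.
  by apply: regV.2; rewrite in_itv /= tb lat.
near=> y; have ty : t < y by near: y; exact: nbhs_right_gt.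
have yb : y < b by near: y; exact: nbhs_right_lt.
by apply: V_le => //; exact: ltW.
Unshelve. all: by end_near. Qed.

Lemma in_ext_base u : in_ext a b u -> a <= ext_base u <= b.
Proof.
by case: u => x /= /andP[]; [move=> /ltW -> | move=> -> | move=> -> /ltW].
Qed.

(** Two extended points with different base points are separated by a genuine
    point, which reduces the claim to the comparison of a value with the
    adjacent one-sided limits. *)
Lemma ext_fun_le u v : in_ext a b u -> in_ext a b v -> ext_le u v ->
  ext_fun V u <= ext_fun V v.
Proof.
move=> iu iv; rewrite /ext_le => /orP[uv|/andP[/eqP uv suv]]; last first.
  case: u v iu iv uv suv => [] x [] y //= iu iv xy _; rewrite {}xy in iu *;
    move: iu iv => /andP[h1 h2] /andP[h3 h4]; rewrite ?lexx//.
  - exact: llim_le.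
  - by rewrite (le_trans (llim_le _ _))// rlim_ge.
  - exact: rlim_ge.
set m := (ext_base u + ext_base v) / 2.
have um : ext_base u < m by rewrite /m midf_lt.
have mv : m < ext_base v by rewrite /m midf_lt.
have am : a <= m.
  by apply: le_trans (ltW um); case/andP: (in_ext_base iu).
have mb : m <= b.
  by apply: le_trans (ltW mv) _; case/andP: (in_ext_base iv).
apply: (@le_trans _ _ (V m)).
- case: u @m iu um mv mb {uv am} => z m /= /andP[h1 h2] zm mv mb.
  + by rewrite (le_trans (llim_le _ _))// V_le// ltW.
  + exact: V_le.
  + exact: rlim_le.
- case: v @m iv um am mv {uv mb} => z m /= /andP[h1 h2] um am zm.
  + exact: llim_ge.
  + exact: V_le.
  + by rewrite (@le_trans _ _ (V z))// ?V_le// ?rlim_ge// ltW.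
Qed.

End ext_monotone.

Section jump_sets.
Context {R : realType} (a b : R).
Implicit Types (f : R -> R) (u v w : ext_point R) (side : bool).

Definition jump side f x :=
  ext_fun f (gap_hi side x) - ext_fun f (gap_lo side x).

Definition gaps side u v : set R :=
  [set x | [&& in_ext a b (gap_lo side x), in_ext a b (gap_hi side x),
               ext_le u (gap_lo side x) & ext_le (gap_hi side x) v]].

(** Stated in the form in which sums and products over a set are split. *)
Lemma gaps_split side u v w : in_ext a b v -> ext_le u v -> ext_le v w ->
  (gaps side u w `&` gaps side u v = gaps side u v) /\
  (gaps side u w `&` ~` gaps side u v = gaps side v w).
Proof.
move=> iv uv vw; split; apply/seteqP; split=> x /=.
- by case.
- move=> h; split=> //; move: h => /and4P[h1 h2 h3 h4]; apply/and4P; split=> //.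
  exact: ext_le_trans vw.
- move=> [/and4P[h1 h2 h3 h4]] h; apply/and4P; split=> //.
  by rewrite gap_cut; apply/negP => h5; apply: h; apply/and4P.
- move=> /and4P[h1 h2 h3 h4]; split.
    by apply/and4P; split=> //; exact: ext_le_trans h3.
  by move=> /and4P[_ _ _]; apply/negP; rewrite -gap_cut.
Qed.

Lemma gaps0 side u : gaps side u u = set0.
Proof.
apply/seteqP; split=> x // /and4P[_ _ h1 h2].
by move: (gap_lt side x); rewrite ext_ltNge (ext_le_trans h2 h1).
Qed.

Lemma gaps1 side x : in_ext a b (gap_lo side x) -> in_ext a b (gap_hi side x) ->
  gaps side (gap_lo side x) (gap_hi side x) = [set x].
Proof.
move=> i1 i2; apply/seteqP; split=> y.
  move=> /and4P[_ _].
  rewrite gap_cut gap_hi_lo -leNgt => xy; apply: contraTeq => yx.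
  by rewrite -gap_cut gap_hi_lo lt_neqAle eq_sym yx.
by move=> ->; apply/and4P; split=> //; rewrite ext_le_refl.
Qed.

Lemma gaps1_other side x :
  gaps (~~ side) (gap_lo side x) (gap_hi side x) = set0.
Proof.
apply/seteqP; split=> y // /and4P[_ _]; case: side; rewrite /ext_le /=;
  by case: (ltgtP x y).
Qed.

End jump_sets.

(** * Sums of squared jumps *)

Section jump_sums.
Context {R : realType} (a b : R) (f V : R -> R).
Hypothesis regV : regulated a b V.
Hypothesis V_le : forall x y, a <= x -> x < y -> y <= b -> V x <= V y.
Hypothesis jumpV : forall side x, in_ext a b (gap_lo side x) ->
  in_ext a b (gap_hi side x) -> jump side V x = jump side f x ^+ 2.
Implicit Types (u v w : ext_point R) (side : bool) (d c : R).

(** Sorting the points makes their gaps consecutive disjoint extended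
    intervals, and V increases between them. *)
Lemma sum_jumps_le side u v (s : seq R) :
  in_ext a b u -> in_ext a b v -> ext_le u v ->
  uniq s -> {in s, forall x, gaps a b side u v x} ->
  \sum_(x <- s) jump side f x ^+ 2 <= ext_fun V v - ext_fun V u.
Proof.
move=> iu iv uv us sg.
have ps : perm_eq s (sort <=%R s) by rewrite perm_sym perm_sort.
rewrite (perm_big _ ps) /=.
have : sorted <%R (sort <=%R s) by rewrite sort_lt_sorted.
have : {in sort <=%R s, forall x, gaps a b side u v x}.
  by move=> x; rewrite mem_sort; exact: sg.
elim: (sort _ s) u iu uv {sg} => [|x l ih] u iu uv sg srt.
  by rewrite big_nil subr_ge0; exact: ext_fun_le iu iv uv.
have /and4P[i1 i2 ul hv] := sg x (mem_head _ _).
rewrite big_cons -jumpV//.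
have /(ih _ i2 hv) : {in l, forall y, gaps a b side (gap_hi side x) v y}.
  move=> y yl; have /and4P[j1 j2 _ yv] : gaps a b side u v y.
    by apply: sg; rewrite inE yl orbT.
  apply/and4P; split=> //; rewrite gap_hi_lo.
  by move: srt; rewrite /= lt_path_sortedE => /andP[/allP /(_ _ yl)].
move=> /(_ (path_sorted srt)).
have := ext_fun_le regV V_le iu i1 ul.
rewrite /jump; lra.
Qed.

Definition big_gaps side u v d : set R :=
  gaps a b side u v `&` [set x | d < `|jump side f x|].

Definition jump_sq side u v : R :=
  fine (\esum_(x in gaps a b side u v) (jump side f x ^+ 2)%:E).

Let sum_fset (A : set R) side : finite_set A ->
  (\sum_(x \in A) (jump side f x ^+ 2)%:E)%E =
  (\sum_(x \in A) jump side f x ^+ 2)%:E.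
Proof. by move=> fA; rewrite !fsbig_finite//= sumEFin. Qed.

Lemma fsum_jumps_le side u v (A : set R) :
  in_ext a b u -> in_ext a b v -> ext_le u v ->
  finite_set A -> A `<=` gaps a b side u v ->
  \sum_(x \in A) jump side f x ^+ 2 <= ext_fun V v - ext_fun V u.
Proof.
move=> iu iv uv fA AG; rewrite fsbig_finite//=.
apply: sum_jumps_le; rewrite ?finmap.fset_uniq//.
by move=> x; rewrite in_fset_set// inE => /AG.
Qed.

Lemma esum_jumps_le side u v : in_ext a b u -> in_ext a b v -> ext_le u v ->
  (\esum_(x in gaps a b side u v) (jump side f x ^+ 2)%:E
     <= (ext_fun V v - ext_fun V u)%:E)%E.
Proof.
move=> iu iv uv; apply: ge_ereal_sup => _ [A [fA AG] <-].
by rewrite sum_fset// lee_fin fsum_jumps_le.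
Qed.

Lemma esum_jumpsE side u v : in_ext a b u -> in_ext a b v -> ext_le u v ->
  (\esum_(x in gaps a b side u v) (jump side f x ^+ 2)%:E
     = (jump_sq side u v)%:E)%E.
Proof.
move=> iu iv uv; rewrite fineK// ge0_fin_numE ?esum_ge0//.
  by rewrite (le_lt_trans (esum_jumps_le _ iu iv uv))// ltry.
by move=> x _; rewrite lee_fin sqr_ge0.
Qed.

(** As V grows by the square of each jump of f, the squares of the jumps are
    summable; in particular only finitely many jumps exceed a threshold. *)
Lemma jump_sq_le side u v : in_ext a b u -> in_ext a b v -> ext_le u v ->
  jump_sq side u v <= ext_fun V v - ext_fun V u.
Proof. by move=> iu iv uv; rewrite -lee_fin -esum_jumpsE// esum_jumps_le. Qed.

Lemma jump_sq_ge0 side u v : 0 <= jump_sq side u v.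
Proof.
by apply: fine_ge0; apply: esum_ge0 => x _; rewrite lee_fin sqr_ge0.
Qed.

Lemma jump_sqD side u v w :
  in_ext a b u -> in_ext a b v -> in_ext a b w -> ext_le u v -> ext_le v w ->
  jump_sq side u w = jump_sq side u v + jump_sq side v w.
Proof.
move=> iu iv iw uv vw; apply: EFin_inj.
rewrite -esum_jumpsE//; last exact: ext_le_trans vw.
rewrite (esumID (gaps a b side u v)); last first.
  by move=> x _; rewrite lee_fin sqr_ge0.
by have [-> ->] := gaps_split side iv uv vw; rewrite !esum_jumpsE.
Qed.

Lemma jump_sq0 side u : jump_sq side u u = 0.
Proof. by rewrite /jump_sq gaps0 esum_set0. Qed.

Lemma fsum_le_jump_sq side u v (A : set R) :
  in_ext a b u -> in_ext a b v -> ext_le u v ->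
  finite_set A -> A `<=` gaps a b side u v ->
  \sum_(x \in A) jump side f x ^+ 2 <= jump_sq side u v.
Proof.
move=> iu iv uv fA AG; rewrite -lee_fin -esum_jumpsE// -sum_fset//.
by apply: esum_ge; exists A.
Qed.

Lemma jump_le_jump_sq side u v x :
  in_ext a b u -> in_ext a b v -> ext_le u v -> gaps a b side u v x ->
  jump side f x ^+ 2 <= jump_sq side u v.
Proof.
move=> iu iv uv gx.
have <- : \sum_(y \in [set x]) jump side f y ^+ 2 = jump side f x ^+ 2.
  exact: fsbig_set1.
by apply: fsum_le_jump_sq => // _ ->.
Qed.

Lemma finite_big_gaps side u v d :
  in_ext a b u -> in_ext a b v -> ext_le u v -> 0 < d ->
  finite_set (big_gaps side u v d).
Proof.
move=> iu iv uv d0; apply: contrapT => inf.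
pose K := ext_fun V v - ext_fun V u.
have [B BG nB] := infinite_set_fset (Num.truncn (K / d ^+ 2)).+1 inf.
have : \sum_(x <- finmap.enum_fset B) jump side f x ^+ 2 <= K.
  by apply: sum_jumps_le; rewrite ?finmap.fset_uniq// => x xB; case: (BG x xB).
apply/negP; rewrite -ltNge.
have : \sum_(x <- finmap.enum_fset B) d ^+ 2 <=
    \sum_(x <- finmap.enum_fset B) jump side f x ^+ 2.
  rewrite big_seq [leRHS]big_seq; apply: ler_sum => x xB.
  have [_ /= dx] := BG x xB.
  by rewrite -(real_normK (num_real (jump side f x)))
    ler_sqr ?nnegrE ?normr_ge0 ?(ltW dx) ?(ltW d0).
apply: lt_le_trans; rewrite big_const_seq count_predT iter_addr_0 -mulr_natr.
rewrite mulrC -ltr_pdivrMr ?exprn_gt0//.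
by apply: (lt_le_trans (truncnS_gt _)); rewrite ler_nat.
Qed.

(** The big jumps exhaust the sum of squares as the threshold decreases to 0,
    since a finite set only has jumps above some threshold, or null ones. *)
Lemma jump_sq_le_big side u v c :
  in_ext a b u -> in_ext a b v -> ext_le u v ->
  (forall d, 0 < d -> \sum_(x \in big_gaps side u v d) jump side f x ^+ 2 <= c) ->
  jump_sq side u v <= c.
Proof.
move=> iu iv uv hc; rewrite -lee_fin -esum_jumpsE//.
apply: ge_ereal_sup => _ [A [fA AG] <-].
rewrite sum_fset// lee_fin.
have [d d0 Ad] : exists2 d, 0 < d &
    forall x, A x -> jump side f x != 0 -> d < `|jump side f x|.
  have : exists2 d, 0 < d &
    forall x, x \in finmap.enum_fset (fset_set A) -> jump side f x != 0 ->
      d < `|jump side f x|.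
    elim: (finmap.enum_fset (fset_set A)) => [|x l [d d0 hd]]; first by exists 1.
    have [j0|j0] := eqVneq (jump side f x) 0.
      exists d => // y; rewrite inE => /orP[/eqP->|]; last exact: hd.
      by rewrite j0 eqxx.
    exists (Num.min d (`|jump side f x| / 2)).
      by rewrite lt_min d0 divr_gt0 ?normr_gt0.
    move=> y; rewrite inE => /orP[/eqP-> _|yl yj].
      rewrite gt_min; apply/orP; right.
      by have : 0 < `|jump side f x|; [rewrite normr_gt0|lra].
    by rewrite gt_min hd.
  move=> [d d0 hd]; exists d => // x Ax; apply: hd.
  by rewrite in_fset_set// inE.
apply: le_trans (hc d d0).
have fb := finite_big_gaps side iu iv uv d0.
rewrite (fsbigID (A `&` big_gaps side u v d))//= -/(setI _ _).
rewrite [X in _ + X]fsbig1 ?addr0; last first.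
  move=> x [Ax nx]; apply/eqP; rewrite sqrf_eq0; apply/eqP.
  apply: contra_notP nx => /eqP jx; split=> //; split; first exact: AG.
  exact: Ad.
rewrite setIA setIid [leRHS](fsbigID A)//= setIC lerDl.
rewrite fsbig_finite; last exact: finite_setIl.
by apply: sumr_ge0 => x _; rewrite sqr_ge0.
Qed.

Lemma jump_sq_gap side x : in_ext a b (gap_lo side x) ->
  in_ext a b (gap_hi side x) ->
  jump_sq side (gap_lo side x) (gap_hi side x) = jump side f x ^+ 2.
Proof.
by move=> i1 i2; rewrite /jump_sq gaps1// esum_set1// lee_fin sqr_ge0.
Qed.

Lemma jump_sq_gap_other side x :
  jump_sq (~~ side) (gap_lo side x) (gap_hi side x) = 0.
Proof. by rewrite /jump_sq gaps1_other esum_set0. Qed.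

End jump_sums.

(** * Products over jumps *)

Section jump_products.
Context {R : realType} (a b : R) (f V : R -> R).
Hypothesis regV : regulated a b V.
Hypothesis V_le : forall x y, a <= x -> x < y -> y <= b -> V x <= V y.
Hypothesis jumpV : forall side x, in_ext a b (gap_lo side x) ->
  in_ext a b (gap_hi side x) -> jump side V x = jump side f x ^+ 2.
Hypothesis jump_neqN1 : forall side x, in_ext a b (gap_lo side x) ->
  in_ext a b (gap_hi side x) -> jump side f x != -1.
Implicit Types (u v w : ext_point R) (side : bool) (d c eta x j : R).

Local Notation big_gaps := (big_gaps a b f).
Local Notation jump_sq := (jump_sq a b f).

Definition jump_factor j := (1 + j) * expR (- j).

Lemma jump_factor0 : jump_factor 0 = 1.
Proof. by rewrite /jump_factor oppr0 expR0 addr0 mulr1. Qed.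

Lemma jump_factor_neq0 j : j != -1 -> jump_factor j != 0.
Proof.
move=> j1; apply: mulf_neq0; last by rewrite gt_eqF ?expR_gt0.
by rewrite addrC addr_eq0.
Qed.

(** The linear term of ln (1 + j) cancels, whence the absolute convergence of
    the product of the factors when the squares of the jumps are summable. *)
Lemma jump_factor_bounds j eta : `|j| <= eta -> eta <= 2^-1 ->
  expR (- (2^-1 + eta) * j ^+ 2) <= jump_factor j
    <= expR (- (2^-1 - eta) * j ^+ 2).
Proof.
move=> je e2; have /andP[lo hi] := expR_quad_bounds je e2.
have E c : expR (c * j ^+ 2) = expR (j + c * j ^+ 2) * expR (- j).
  by rewrite -expRD; congr expR; ring.
apply/andP; split; rewrite E /jump_factor ler_pM2r ?expR_gt0//.
  by apply: le_trans lo; rewrite ler_expR; lra.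
by apply: le_trans hi _; rewrite ler_expR; lra.
Qed.

Definition jump_prod_gt side u v d : R :=
  \big[*%R/1]_(x \in big_gaps side u v d) jump_factor (jump side f x).

Definition jump_prod side u v : R :=
  lim (jump_prod_gt side u v d @[d --> 0^'+]).

Lemma fprod_bounds side (A : set R) eta : finite_set A -> eta <= 2^-1 ->
  (forall x, A x -> `|jump side f x| <= eta) ->
  expR (- (2^-1 + eta) * \sum_(x \in A) jump side f x ^+ 2)
    <= \big[*%R/1]_(x \in A) jump_factor (jump side f x)
    <= expR (- (2^-1 - eta) * \sum_(x \in A) jump side f x ^+ 2).
Proof.
move=> fA e2 hA; rewrite !fsbig_finite//=.
have : {in finmap.enum_fset (fset_set A), forall x, `|jump side f x| <= eta}.
  by move=> x; rewrite in_fset_set// inE; exact: hA.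
elim: (finmap.enum_fset _) => [|x l ih] hl.
  by rewrite !big_nil !mulr0 expR0 lexx.
rewrite !big_cons !mulrDr !expRD.
have /andP[l1 l2] : expR (- (2^-1 + eta) * \sum_(j <- l) jump side f j ^+ 2) <=
  \prod_(j <- l) jump_factor (jump side f j) <=
  expR (- (2^-1 - eta) * \sum_(j <- l) jump side f j ^+ 2).
  by apply: ih => y yl; apply: hl; rewrite inE yl orbT.
have /andP[x1 x2] := jump_factor_bounds (hl x (mem_head _ _)) e2.
by rewrite !ler_pM ?expR_ge0// ?(le_trans _ l1) ?(le_trans _ x1) ?expR_ge0.
Qed.

Lemma big_gaps_antitone side u v d d' : d' <= d ->
  big_gaps side u v d `<=` big_gaps side u v d'.
Proof. by move=> dd x [gx /= dx]; split=> //=; exact: le_lt_trans dx. Qed.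

Definition mid_prod side u v c d : R :=
  \big[*%R/1]_(x \in big_gaps side u v d `&` ~` big_gaps side u v c)
     jump_factor (jump side f x).

Section convergence.
Variables (side : bool) (u v : ext_point R).
Hypotheses (iu : in_ext a b u) (iv : in_ext a b v) (uv : ext_le u v).

Let fin d : 0 < d -> finite_set (big_gaps side u v d).
Proof. exact: (finite_big_gaps regV V_le jumpV). Qed.

Lemma jump_prod_gt_split c d : 0 < d -> d <= c ->
  jump_prod_gt side u v d = jump_prod_gt side u v c * mid_prod side u v c d.
Proof.
move=> d0 dc; rewrite /jump_prod_gt.
rewrite (fsbigID (big_gaps side u v c))/=; last exact: fin.
by rewrite setIC (setIidl (@big_gaps_antitone _ _ _ _ _ dc)).
Qed.

Lemma mid_prod_bounds c d : 0 < d -> 0 <= c -> c <= 2^-1 ->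
  expR (- (2^-1 + c) * jump_sq side u v) <= mid_prod side u v c d <= 1.
Proof.
move=> d0 c0 c2.
have fA : finite_set (big_gaps side u v d `&` ~` big_gaps side u v c).
  by apply: finite_setIl; exact: fin.
have [|lo hi] := andP (@fprod_bounds side _ c fA c2 _).
  move=> x [[gx _] nx]; rewrite leNgt; apply/negP => cx; exact: nx.
have s0 : 0 <= \sum_(x \in big_gaps side u v d `&` ~` big_gaps side u v c)
    jump side f x ^+ 2.
  by rewrite fsbig_finite//; apply: sumr_ge0 => x _; rewrite sqr_ge0.
apply/andP; split.
  apply: le_trans lo; rewrite ler_expR !mulNr lerN2 ler_wpM2l ?addr_ge0//.
  apply: (fsum_le_jump_sq regV V_le jumpV) => //.
  by move=> x [[]].
by apply: le_trans hi _; rewrite expR_le1 mulNr oppr_le0 mulr_ge0 ?subr_ge0.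
Qed.

(** Factors of jumps of size at most 1/2 lie in (0, 1], so including more of
    them decreases the product: this monotonicity replaces a Cauchy argument. *)
Lemma mid_prod_homo c d d' : 0 < d' -> d' <= d -> d <= c -> c <= 2^-1 ->
  mid_prod side u v c d' <= mid_prod side u v c d.
Proof.
move=> d0 dd dc c2; have d1 : 0 < d by exact: lt_le_trans dd.
have c0 : 0 <= c by apply: le_trans dc; exact: ltW.
have -> : mid_prod side u v c d' =
    mid_prod side u v c d * mid_prod side u v d d'.
  rewrite {1}/mid_prod (fsbigID (big_gaps side u v d))/=; last first.
    by apply: finite_setIl; exact: fin.
  congr (_ * _).
    apply: eq_fsbigl; apply/seteqP; split=> x; first by move=> [[_ h] k].
    by move=> [h k]; split=> //; split=> //; exact: big_gaps_antitone h.
  apply: eq_fsbigl; apply/seteqP; split=> x; first by move=> [[]].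
  move=> [h1 h2]; split=> //; split=> // h3; apply: h2.
  exact: big_gaps_antitone h3.
have /andP[lo hi] := mid_prod_bounds d1 c0 c2.
have /andP[_ hi'] := mid_prod_bounds d0 (ltW d1) (le_trans dc c2).
by rewrite ler_piMr// (le_trans _ lo)// expR_ge0.
Qed.

Lemma mid_prod_cvg : exists2 l, mid_prod side u v 2^-1 d @[d --> 0^'+] --> l &
  expR (- (2^-1 + 2^-1) * jump_sq side u v) <= l.
Proof.
have /cvg_ex[l ml] : cvg (mid_prod side u v 2^-1 d @[d --> 0^'+]).
  apply: nondecreasing_at_right_is_cvgr.
    near=> r => d d'; rewrite !in_itv /= => /andP[d0 dr] /andP[d'0 d'r] dd'.
    apply: mid_prod_homo => //; apply: le_trans (ltW d'r) _.
    by near: r; apply: nbhs_right_le; rewrite invr_gt0.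
  near=> r; exists 0 => _ [d /= + <-]; rewrite in_itv /= => /andP[d0 _].
  have /andP[lo _] : expR (- (2^-1 + 2^-1) * jump_sq side u v)
    <= mid_prod side u v 2^-1 d <= 1 by apply: mid_prod_bounds; rewrite ?invr_ge0.
  by rewrite (le_trans _ lo)// expR_ge0.
exists l => //; apply: (cvgr_to_ge ml).
near=> d; have d0 : 0 < d by near: d; exact: nbhs_right_gt.
by have /andP[] : expR (- (2^-1 + 2^-1) * jump_sq side u v)
    <= mid_prod side u v 2^-1 d <= 1 by apply: mid_prod_bounds; rewrite ?invr_ge0.
Unshelve. all: by end_near. Qed.

Lemma jump_prod_gt_neq0 d : 0 < d -> jump_prod_gt side u v d != 0.
Proof.
move=> d0; rewrite /jump_prod_gt fsbig_finite; last exact: fin.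
rewrite prodf_seq_neq0; apply/allP => x.
rewrite in_fset_set ?inE; last exact: fin.
by move=> [/and4P[i1 i2 _ _] _]; rewrite jump_factor_neq0 ?jump_neqN1.
Qed.

(** The finitely many jumps of size above 1/2 contribute a nonzero constant factor
    of arbitrary sign; the others a monotone product bounded away from 0. *)
Lemma jump_prod_cvg_neq0 :
  jump_prod_gt side u v d @[d --> 0^'+] --> jump_prod side u v /\
  jump_prod side u v != 0.
Proof.
have [l ml l0] := mid_prod_cvg.
have gl : jump_prod_gt side u v d @[d --> 0^'+] -->
    jump_prod_gt side u v 2^-1 * l.
  apply: (@cvg_trans _ ((jump_prod_gt side u v 2^-1 * mid_prod side u v 2^-1 d)
            @[d --> 0^'+])); last by apply: cvgM => //; exact: cvg_cst.
  apply: near_eq_cvg; near=> d; rewrite -jump_prod_gt_split//.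
  by near: d; apply: nbhs_right_le; rewrite invr_gt0.
have -> : jump_prod side u v = jump_prod_gt side u v 2^-1 * l.
  exact: cvg_lim gl.
split=> //; apply: mulf_neq0; first by rewrite jump_prod_gt_neq0// invr_gt0.
by rewrite gt_eqF// (lt_le_trans _ l0)// expR_gt0.
Unshelve. all: by end_near. Qed.

(** Small jumps: the product is exp(- jump_sq / 2) up to a relative error of
    order eta in the exponent. *)
Lemma jump_prod_bounds eta : 0 <= eta -> eta <= 4^-1 ->
  (forall x, gaps a b side u v x -> `|jump side f x| <= eta) ->
  expR (- (2^-1 + eta) * jump_sq side u v) <= jump_prod side u v
    <= expR (- (2^-1 - eta) * jump_sq side u v).
Proof.
move=> eta0 e4 he; have [gl gn0] := jump_prod_cvg_neq0.
have e2 : eta <= 2^-1 by lra.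
have bnd d : 0 < d ->
    expR (- (2^-1 + eta) * \sum_(x \in big_gaps side u v d) jump side f x ^+ 2)
    <= jump_prod_gt side u v d
    <= expR (- (2^-1 - eta) * \sum_(x \in big_gaps side u v d) jump side f x ^+ 2).
  by move=> d0; apply: fprod_bounds => //; [exact: fin|move=> x [/he]].
have lo : expR (- (2^-1 + eta) * jump_sq side u v) <= jump_prod side u v.
  apply: (cvgr_to_ge gl); near=> d.
  have d0 : 0 < d by near: d; exact: nbhs_right_gt.
  have /andP[l _] := bnd d d0; apply: le_trans l.
  rewrite ler_expR !mulNr lerN2 ler_wpM2l ?addr_ge0//.
  by apply: (fsum_le_jump_sq regV V_le jumpV) => //; [exact: fin|move=> x []].
have g0 : 0 < jump_prod side u v by apply: lt_le_trans lo; rewrite expR_gt0.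
(* The upper bound is read as a bound on jump_sq, so that it suffices to check
   it on the jumps above each threshold. *)
rewrite lo /= -(lnK g0) ler_expR.
have e0 : 0 < 2^-1 - eta by lra.
rewrite mulNr lerNr -ler_pdivlMl//.
apply: (jump_sq_le_big regV V_le jumpV) => // d d0.
rewrite ler_pdivlMl// lerNr -ler_expR lnK// -mulNr.
have /andP[_] := bnd d d0; apply: le_trans.
(* All factors are at most 1, so the products decrease with the threshold. *)
apply: (cvgr_to_le gl); near=> d'.
have d'0 : 0 < d' by near: d'; exact: nbhs_right_gt.
have d'd : d' <= d by near: d'; exact: nbhs_right_le.
rewrite (jump_prod_gt_split d'0 d'd) ler_piMr//.
  by have /andP[l _] := bnd d d0; rewrite (le_trans _ l)// expR_ge0.
have fA : finite_set (big_gaps side u v d' `&` ~` big_gaps side u v d).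
  by apply: finite_setIl; exact: fin.
have [|_ hi] := andP (@fprod_bounds side _ eta fA e2 _).
  by move=> x [[/he]].
apply: le_trans hi _; rewrite expR_le1 mulNr oppr_le0 mulr_ge0 ?(ltW e0)//.
by rewrite fsbig_finite//; apply: sumr_ge0 => x _; rewrite sqr_ge0.
Unshelve. all: by end_near. Qed.

End convergence.

Lemma jump_prodM side u v w :
  in_ext a b u -> in_ext a b v -> in_ext a b w -> ext_le u v -> ext_le v w ->
  jump_prod side u w = jump_prod side u v * jump_prod side v w.
Proof.
move=> iu iv iw uv vw; have uw := ext_le_trans uv vw.
have [g1 _] := jump_prod_cvg_neq0 side iu iv uv.
have [g2 _] := jump_prod_cvg_neq0 side iv iw vw.
apply: cvg_lim => //.
apply: cvg_trans (cvgM g1 g2); apply: near_eq_cvg; near=> d.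
have d0 : 0 < d by near: d; exact: nbhs_right_gt.
rewrite /jump_prod_gt [RHS](fsbigID (gaps a b side u v))/=; last first.
  exact: (finite_big_gaps regV V_le jumpV).
have [s1 s2] := gaps_split side iv uv vw.
by rewrite /big_gaps (setIAC _ _ (gaps _ _ _ _ _)) s1 (setIAC _ _ (~` _)) s2.
Unshelve. all: by end_near. Qed.

Lemma jump_prod_gap side x : in_ext a b (gap_lo side x) ->
  in_ext a b (gap_hi side x) ->
  jump_prod side (gap_lo side x) (gap_hi side x) = jump_factor (jump side f x).
Proof.
move=> i1 i2; apply: cvg_lim => //; apply: cvg_near_cst.
rewrite /jump_prod_gt /big_gaps gaps1//.
have [j0|j0] := eqVneq (jump side f x) 0.
  near=> d; have d0 : 0 < d by near: d; exact: nbhs_right_gt.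
  rewrite (_ : _ `&` _ = set0) ?fsbig_set0 ?j0 ?jump_factor0//.
  apply/seteqP; split=> // y [-> /=]; rewrite j0 normr0 => /ltW.
  by rewrite leNgt d0.
near=> d; rewrite (_ : _ `&` _ = [set x]) ?fsbig_set1//.
apply/seteqP; split=> [y []//|y ->]; split=> //=.
by near: d; apply: nbhs_right_lt; rewrite normr_gt0.
Unshelve. all: by end_near. Qed.

Lemma jump_prod_gap_other side x :
  jump_prod (~~ side) (gap_lo side x) (gap_hi side x) = 1.
Proof.
apply: cvg_lim => //; apply: cvg_near_cst; near=> d.
by rewrite /jump_prod_gt /big_gaps gaps1_other set0I fsbig_set0.
Unshelve. all: by end_near. Qed.

Lemma jump_prod0 side u : jump_prod side u u = 1.
Proof.
apply: cvg_lim => //; apply: cvg_near_cst; near=> d.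
by rewrite /jump_prod_gt /big_gaps gaps0 set0I fsbig_set0.
Unshelve. all: by end_near. Qed.

End jump_products.

(** * The function beta *)

Section one_sided_limits.
Context {R : realType} (a b : R).
Implicit Types (F : R -> R) (Phi : ext_point R -> R).

(** Recognizes an explicitly given function on the extended interval as the
    extension of a regulated function by its one-sided limits. *)
Lemma ext_fun_lim F Phi :
  (forall t, a <= t <= b -> F t = Phi (Pt t)) ->
  (forall t, a < t <= b -> F x @[x --> t^'-] --> Phi (LPt t)) ->
  (forall t, a <= t < b -> F x @[x --> t^'+] --> Phi (RPt t)) ->
  regulated a b F /\ forall u, in_ext a b u -> ext_fun F u = Phi u.
Proof.
move=> F0 F1 F2; split; first by split=> t; rewrite in_itv /= => tab;
  apply/cvg_ex; eexists; [exact: F1|exact: F2].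
by case=> t /= tab; [apply: cvg_lim => //; exact: F1|exact: F0|
  apply: cvg_lim => //; exact: F2].
Qed.

Lemma cvg_to_llim F t : regulated a b F -> a < t <= b ->
  F x @[x --> t^'-] --> llim F t.
Proof. by move=> [rF _] tab; apply: rF; rewrite in_itv. Qed.

Lemma cvg_to_rlim F t : regulated a b F -> a <= t < b ->
  F x @[x --> t^'+] --> rlim F t.
Proof. by move=> [_ rF] tab; apply: rF; rewrite in_itv. Qed.

End one_sided_limits.

(** Convergence to 1, in the multiplicative form in which it is combined. *)
Lemma cvg1P {R : realType} {T : Type} (F : set_system T) {FF : Filter F}
    (h : T -> R) :
  h x @[x --> F] --> (1 : R) <->
  forall e : R, 0 < e -> \forall x \near F, expR (- e) <= h x <= expR e.
Proof.
split=> [h1 e e0|H].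
  near=> x; apply/andP; split; near: x;
    [apply: (@cvgr_ge _ _ _ _ _ _ h1)|apply: (@cvgr_le _ _ _ _ _ _ h1)].
    by rewrite expR_lt1 oppr_lt0.
  by rewrite expR_gt1.
apply/cvgrPdist_le => /= e e0.
have [d d0 hd] : exists2 d : R, 0 < d & expR d <= 1 + e.
  exists (ln (1 + e)); first by rewrite ln_gt0// ltrDl.
  by rewrite lnK// posrE addr_gt0.
near=> x; have /andP[lo hi] : expR (- d) <= h x <= expR d.
  by near: x; exact: H.
have : 1 - e <= expR (- d).
  have := expR_ge1Dx (- d); have := expR_ge1Dx d; lra.
by rewrite ler_norml; lra.
Unshelve. all: by end_near. Qed.

Section beta_function.
Context {R : realType} (a b : R) (f V : R -> R).
Hypothesis hab : a < b.
Hypothesis regf : regulated a b f.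
Hypothesis regV : regulated a b V.
Hypothesis V_le : forall x y, a <= x -> x < y -> y <= b -> V x <= V y.
Hypothesis jumpV : forall side x, in_ext a b (gap_lo side x) ->
  in_ext a b (gap_hi side x) -> jump side V x = jump side f x ^+ 2.
Hypothesis jump_neqN1 : forall side x, in_ext a b (gap_lo side x) ->
  in_ext a b (gap_hi side x) -> jump side f x != -1.
Implicit Types (u v w : ext_point R) (side : bool) (d c eta x j : R).

Local Notation jump_sq := (jump_sq a b f).
Local Notation jump_prod := (jump_prod a b f).

Definition all_jump_sq u v := jump_sq false u v + jump_sq true u v.

Definition ext_incr (h : R -> R) u v := ext_fun h v - ext_fun h u.

(** The function beta, with the continuous part of the quadratic variation
    written as the variation less the squares of the jumps. *)
Definition beta_incr u v :=
  expR (ext_incr f u v - 2^-1 * (ext_incr V u v - all_jump_sq u v))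
  * (jump_prod false u v * jump_prod true u v).

Lemma all_jump_sqD u v w :
  in_ext a b u -> in_ext a b v -> in_ext a b w -> ext_le u v -> ext_le v w ->
  all_jump_sq u w = all_jump_sq u v + all_jump_sq v w.
Proof.
move=> iu iv iw uv vw; rewrite /all_jump_sq.
by rewrite !(jump_sqD regV V_le jumpV _ iu iv iw uv vw) addrACA.
Qed.

Lemma all_jump_sq_ge0 u v : 0 <= all_jump_sq u v.
Proof. by rewrite addr_ge0 ?jump_sq_ge0. Qed.

Lemma all_jump_sq_le u v : in_ext a b u -> in_ext a b v -> ext_le u v ->
  all_jump_sq u v <= 2 * ext_incr V u v.
Proof.
move=> iu iv uv; rewrite mulr_natl mulr2n lerD//;
  exact: (jump_sq_le regV V_le jumpV).
Qed.

Lemma beta_incrM u v w :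
  in_ext a b u -> in_ext a b v -> in_ext a b w -> ext_le u v -> ext_le v w ->
  beta_incr u w = beta_incr u v * beta_incr v w.
Proof.
move=> iu iv iw uv vw; rewrite /beta_incr (all_jump_sqD iu iv iw uv vw).
rewrite !(jump_prodM regV V_le jumpV jump_neqN1 _ iu iv iw uv vw).
rewrite (_ : ext_incr f u w - _ = (ext_incr f u v - 2^-1 *
  (ext_incr V u v - all_jump_sq u v)) + (ext_incr f v w - 2^-1 *
  (ext_incr V v w - all_jump_sq v w))); last by rewrite /ext_incr; ring.
by rewrite expRD; ring.
Qed.

Lemma beta_incr_neq0 u v : in_ext a b u -> in_ext a b v -> ext_le u v ->
  beta_incr u v != 0.
Proof.
move=> iu iv uv; apply: mulf_neq0; first by rewrite gt_eqF ?expR_gt0.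
by apply: mulf_neq0;
  apply: (jump_prod_cvg_neq0 regV V_le jumpV jump_neqN1 _ iu iv uv).2.
Qed.

Lemma beta_incrxx u : beta_incr u u = 1.
Proof.
by rewrite /beta_incr /all_jump_sq !jump_sq0 !jump_prod0 /ext_incr !subrr
  addr0 subr0 mulr0 subr0 expR0 !mulr1.
Qed.

(** Over a single gap the variation increases by exactly the square of the jump,
    so the exponential is exp(j) and cancels the one in jump_factor j. *)
Lemma beta_incr_gap side x : in_ext a b (gap_lo side x) ->
  in_ext a b (gap_hi side x) ->
  beta_incr (gap_lo side x) (gap_hi side x) = 1 + jump side f x.
Proof.
move=> i1 i2; rewrite /beta_incr.
have -> : ext_incr V (gap_lo side x) (gap_hi side x) = jump side f x ^+ 2.
  by rewrite -jumpV.
have -> : all_jump_sq (gap_lo side x) (gap_hi side x) = jump side f x ^+ 2.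
  rewrite /all_jump_sq; case: side i1 i2 => i1 i2.
    by rewrite (jump_sq_gap f i1 i2) (jump_sq_gap_other a b f true) add0r.
  by rewrite (jump_sq_gap f i1 i2) (jump_sq_gap_other a b f false) addr0.
have -> : jump_prod false (gap_lo side x) (gap_hi side x) *
    jump_prod true (gap_lo side x) (gap_hi side x)
    = jump_factor (jump side f x).
  case: side i1 i2 => i1 i2.
    by rewrite (jump_prod_gap f i1 i2) (jump_prod_gap_other a b f true) mul1r.
  by rewrite (jump_prod_gap f i1 i2) (jump_prod_gap_other a b f false) mulr1.
rewrite subrr mulr0 subr0 /jump_factor mulrCA.
by rewrite /ext_incr -/(jump side f x) expRxMexpNx_1 mulr1.
Qed.

(** When the jumps inside [u, v] are small, the factor exp(- J / 2) coming from
    the product over jumps restores the part of the variation that was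
    subtracted, so that only the full variation of f remains. *)
Lemma beta_incr_bounds u v eta :
  in_ext a b u -> in_ext a b v -> ext_le u v -> 0 <= eta -> eta <= 4^-1 ->
  (forall side x, gaps a b side u v x -> `|jump side f x| <= eta) ->
  expR (ext_incr f u v - 2^-1 * ext_incr V u v - 2 * eta * ext_incr V u v)
    <= beta_incr u v <=
  expR (ext_incr f u v - 2^-1 * ext_incr V u v + 2 * eta * ext_incr V u v).
Proof.
move=> iu iv uv e0 e4 he.
have /andP[l1 h1] :=
  jump_prod_bounds regV V_le jumpV jump_neqN1 iu iv uv e0 e4 (he false).
have /andP[l2 h2] :=
  jump_prod_bounds regV V_le jumpV jump_neqN1 iu iv uv e0 e4 (he true).
have Jle := ler_wpM2l e0 (all_jump_sq_le iu iv uv).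
have J0 := mulr_ge0 e0 (all_jump_sq_ge0 u v).
move: Jle J0; rewrite /all_jump_sq => Jle J0.
rewrite /beta_incr /all_jump_sq; apply/andP; split.
  apply: (@le_trans _ _ (expR (ext_incr f u v - 2^-1 * (ext_incr V u v -
    (jump_sq false u v + jump_sq true u v))) *
    (expR (- (2^-1 + eta) * jump_sq false u v) *
     expR (- (2^-1 + eta) * jump_sq true u v)))).
    by rewrite -!expRD ler_expR; lra.
  by rewrite ler_wpM2l ?expR_ge0// ler_pM ?expR_ge0.
apply: (@le_trans _ _ (expR (ext_incr f u v - 2^-1 * (ext_incr V u v -
    (jump_sq false u v + jump_sq true u v))) *
    (expR (- (2^-1 - eta) * jump_sq false u v) *
     expR (- (2^-1 - eta) * jump_sq true u v)))).
  by rewrite ler_wpM2l ?expR_ge0// ler_pM ?(le_trans _ l1) ?(le_trans _ l2)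
    ?expR_ge0.
by rewrite -!expRD ler_expR; lra.
Qed.

(** Uniform smallness of beta over short intervals, whence its one-sided
    limits. Small variation forces small jumps, since their squares sum to at
    most the variation. *)
Lemma beta_incr_near1 e : 0 < e -> exists2 d, 0 < d & forall u v,
  in_ext a b u -> in_ext a b v -> ext_le u v ->
  `|ext_incr f u v| <= d -> ext_incr V u v <= d ->
  expR (- e) <= beta_incr u v <= expR e.
Proof.
move=> e0; exists (Num.min (e / 2) (4^-1 ^+ 2)).
  by rewrite lt_min divr_gt0// exprn_gt0// invr_gt0.
move=> u v iu iv uv; rewrite !le_min => /andP[fe _] /andP[Ve Vd].
have V0 : 0 <= ext_incr V u v.
  by rewrite subr_ge0; exact: (ext_fun_le regV V_le).
have he side x : gaps a b side u v x -> `|jump side f x| <= 4^-1.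
  move=> gx; rewrite -ler_sqr ?nnegrE// ?invr_ge0// real_normK ?num_real//.
  apply: le_trans Vd; apply: (@le_trans _ _ (jump_sq side u v)).
    exact: (jump_le_jump_sq regV V_le jumpV).
  exact: (jump_sq_le regV V_le jumpV).
have q0 : 0 <= 4^-1 :> R by rewrite invr_ge0.
have /andP[lo hi] := beta_incr_bounds iu iv uv q0 (lexx _) he.
move: fe; rewrite ler_norml => /andP[f1 f2].
apply/andP; split.
  by apply: le_trans lo; rewrite ler_expR; lra.
by apply: le_trans hi _; rewrite ler_expR; lra.
Qed.

Lemma all_jump_sq_llim t : a < t <= b ->
  all_jump_sq (Pt a) (Pt x) @[x --> t^'-] --> all_jump_sq (Pt a) (LPt t).
Proof.
move=> /[dup] tab /andP[lat tb]; apply/cvgrPdist_le => e e0.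
near=> x.
have xt : x < t by near: x; exact: nbhs_left_lt.
have ax : a < x by near: x; exact: nbhs_left_gt.
have ia : in_ext a b (Pt a) by rewrite /= lexx ltW.
have ix : in_ext a b (Pt x) by rewrite /= !ltW// (lt_le_trans xt).
have lax : ext_le (Pt a) (Pt x) by rewrite /ext_le /= ax.
have lxt : ext_le (Pt x) (LPt t) by rewrite /ext_le /= xt.
rewrite (all_jump_sqD ia ix (tab : in_ext a b (LPt t)) lax lxt).
rewrite addrAC subrr add0r ger0_norm ?all_jump_sq_ge0//.
apply: le_trans (all_jump_sq_le ix (tab : in_ext a b (LPt t)) lxt) _.
rewrite -ler_pdivlMl// mulrC /ext_incr /=.
apply: le_trans (ler_norm _) _; near: x.
by apply: cvgr_dist_le; [exact: cvg_to_llim regV tab|rewrite divr_gt0].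
Unshelve. all: by end_near. Qed.

Lemma all_jump_sq_rlim t : a <= t < b ->
  all_jump_sq (Pt a) (Pt x) @[x --> t^'+] --> all_jump_sq (Pt a) (RPt t).
Proof.
move=> /[dup] tab /andP[lat tb]; apply/cvgrPdist_le => e e0.
near=> x.
have tx : t < x by near: x; exact: nbhs_right_gt.
have xb : x < b by near: x; exact: nbhs_right_lt.
have ia : in_ext a b (Pt a) by rewrite /= lexx ltW.
have ix : in_ext a b (Pt x) by rewrite /= !ltW// (le_lt_trans lat).
have lta : ext_le (Pt a) (RPt t).
  by rewrite /ext_le /=; case: ltgtP lat.
have ltx : ext_le (RPt t) (Pt x) by rewrite /ext_le /= tx.
rewrite (all_jump_sqD ia (tab : in_ext a b (RPt t)) ix lta ltx).
rewrite opprD addrA subrr add0r normrN ger0_norm ?all_jump_sq_ge0//.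
apply: le_trans (all_jump_sq_le (tab : in_ext a b (RPt t)) ix ltx) _.
rewrite -ler_pdivlMl// mulrC /ext_incr /=.
apply: le_trans (ler_norm _) _; rewrite distrC; near: x.
by apply: cvgr_dist_le; [exact: cvg_to_rlim regV tab|rewrite divr_gt0].
Unshelve. all: by end_near. Qed.

Definition beta_fun x := beta_incr (Pt a) (Pt x).

Lemma beta_fun_lim : regulated a b beta_fun /\
  forall u, in_ext a b u -> ext_fun beta_fun u = beta_incr (Pt a) u.
Proof.
have ia : in_ext a b (Pt a) by rewrite /= lexx ltW.
apply: ext_fun_lim => // t /[dup] tab /andP[h1 h2].
- have il : in_ext a b (LPt t) := tab.
  have lat : ext_le (Pt a) (LPt t) by rewrite /ext_le /= h1.
  have E : beta_incr (Pt x) (LPt t) @[x --> t^'-] --> (1 : R).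
    apply/cvg1P => e e0; have [d d0 hd] := beta_incr_near1 e0.
    near=> x.
    have xt : x < t by near: x; exact: nbhs_left_lt.
    have ax : a < x by near: x; exact: nbhs_left_gt.
    apply: hd => //.
    + by rewrite /= !ltW// (lt_le_trans xt).
    + by rewrite /ext_le /= xt.
    + by near: x; apply: cvgr_dist_le => //; exact: cvg_to_llim regf tab.
    + apply: le_trans (ler_norm _) _.
      by near: x; apply: cvgr_dist_le => //; exact: cvg_to_llim regV tab.
  rewrite -[X in _ --> X]divr1.
  apply: cvg_trans (cvgM (cvg_cst _) (cvgV _ E)); last exact: oner_neq0.
  apply: near_eq_cvg; near=> x.
  have xt : x < t by near: x; exact: nbhs_left_lt.
  have ax : a < x by near: x; exact: nbhs_left_gt.
  have ix : in_ext a b (Pt x) by rewrite /= !ltW// (lt_le_trans xt).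
  have lax : ext_le (Pt a) (Pt x) by rewrite /ext_le /= ax.
  have lxt : ext_le (Pt x) (LPt t) by rewrite /ext_le /= xt.
  rewrite /beta_fun /= (beta_incrM ia ix il lax lxt) mulfK//.
  exact: beta_incr_neq0.
- have il : in_ext a b (RPt t) := tab.
  have lat : ext_le (Pt a) (RPt t).
    by rewrite /ext_le /=; case: ltgtP h1.
  have E : beta_incr (RPt t) (Pt x) @[x --> t^'+] --> (1 : R).
    apply/cvg1P => e e0; have [d d0 hd] := beta_incr_near1 e0.
    near=> x.
    have tx : t < x by near: x; exact: nbhs_right_gt.
    have xb : x < b by near: x; exact: nbhs_right_lt.
    apply: hd => //.
    + by rewrite /= !ltW// (le_lt_trans h1).
    + by rewrite /ext_le /= tx.
    + rewrite distrC.
      by near: x; apply: cvgr_dist_le => //; exact: cvg_to_rlim regf tab.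
    + apply: le_trans (ler_norm _) _; rewrite distrC.
      by near: x; apply: cvgr_dist_le => //; exact: cvg_to_rlim regV tab.
  rewrite -[X in _ --> X]mulr1.
  apply: cvg_trans (cvgM (cvg_cst _) E); apply: near_eq_cvg; near=> x.
  have tx : t < x by near: x; exact: nbhs_right_gt.
  have xb : x < b by near: x; exact: nbhs_right_lt.
  have ix : in_ext a b (Pt x) by rewrite /= !ltW// (le_lt_trans h1).
  have ltx : ext_le (RPt t) (Pt x) by rewrite /ext_le /= tx.
  by rewrite /beta_fun /= (beta_incrM ia il ix lat ltx).
Unshelve. all: by end_near. Qed.

End beta_function.

(** * Local-to-global principle and chains *)

Section segment_induction.
Context {R : realType}.
Implicit Types (x y z s t : R).

(** One-sided neighbourhoods as intervals, for use with [segment_induction]. *)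
Lemma near_at_right x (P : R -> Prop) :
  (\forall t \near x^'+, P t) <-> exists2 d, x < d & forall t, x < t < d -> P t.
Proof.
split=> [/nbhs_ballP[e /= e0 he]|[d xd hd]].
  exists (x + e); first by rewrite ltrDl.
  move=> t /andP[xt te]; apply: he => //.
  by rewrite /ball /= distrC gtr0_norm ?subr_gt0// ltrBlDl.
near=> t; apply: hd; apply/andP; split; near: t.
  exact: nbhs_right_gt.
exact: nbhs_right_lt.
Unshelve. all: by end_near. Qed.

Lemma near_at_left x (P : R -> Prop) :
  (\forall t \near x^'-, P t) <-> exists2 d, d < x & forall t, d < t < x -> P t.
Proof.
split=> [/nbhs_ballP[e /= e0 he]|[d xd hd]].
  exists (x - e); first by rewrite gtrBl.
  move=> t /andP[te tx]; apply: he => //.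
  by rewrite /ball /= gtr0_norm ?subr_gt0// ltrBlDl -ltrBlDr.
near=> t; apply: hd; apply/andP; split; near: t.
  exact: nbhs_left_gt.
exact: nbhs_left_lt.
Unshelve. all: by end_near. Qed.

(** A property of intervals that is stable under concatenation and holds for all
    short enough intervals ending at or starting from any given point holds for
    every interval: otherwise look at the supremum of the points that can be
    reached from s. *)
Lemma segment_induction (a b : R) (P : R -> R -> Prop) :
  (forall x y z, a <= x -> x < y -> y < z -> z <= b ->
     P x y -> P y z -> P x z) ->
  (forall x, a <= x < b -> \forall t \near x^'+, P x t) ->
  (forall x, a < x <= b -> \forall s \near x^'-, P s x) ->
  forall s t, a <= s -> s < t -> t <= b -> P s t.
Proof.
move=> Pcat Pr Pl s t as_ st tb.
pose S := [set z | s < z <= t /\ P s z].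
have extend c : s <= c -> c < t -> (s < c -> P s c) -> exists2 z, c < z & S z.
  move=> sc ct Psc.
  have /near_at_right[d cd hd] : \forall z \near c^'+, P c z.
    by apply: Pr; rewrite (le_trans as_ sc) (lt_le_trans ct tb).
  have cz : c < (c + Num.min d t) / 2 < Num.min d t by rewrite !midf_lt// lt_min cd.
  move: cz; set z := (c + _) / 2; rewrite lt_min => /and3P[cz zd zt].
  have Pcz : P c z by apply: hd; rewrite cz.
  exists z => //; split; first by rewrite (le_lt_trans sc cz) ltW.
  move: sc; rewrite le_eqVlt => /orP[/eqP->//|sc].
  by apply: (@Pcat s c z) => //; [exact: le_trans (ltW zt) tb|exact: Psc].
have [z0 sz0 Sz0] : exists2 z, s < z & S z.
  by apply: extend => //; rewrite ltxx.
have Sub : has_ubound S by exists t => z [/andP[]].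
have Ssup : has_sup S by split => //; exists z0.
set c := sup S.
have sc : s < c by apply: lt_le_trans sz0 _; exact: ub_le_sup.
have ct : c <= t by apply: ge_sup => //; [exists z0|move=> z [/andP[]]].
have Psc : P s c.
  have /near_at_left[d dc hd] : \forall z \near c^'-, P z c.
    by apply: Pl; rewrite (le_lt_trans as_ sc) (le_trans ct tb).
  have [z Sz zc] := @sup_adherent _ S (c - d) (etrans (subr_gt0 _ _) dc) Ssup.
  have {}zc : d < z by move: zc; rewrite -/c opprB addrC subrK.
  have : z <= c by exact: ub_le_sup.
  rewrite le_eqVlt => /orP[/eqP <-|zc']; first by case: Sz.
  have [/andP[sz _] Psz] := Sz.
  apply: (@Pcat s z c) => //; first exact: le_trans ct tb.
  by apply: hd; rewrite zc.
move: ct; rewrite le_eqVlt => /orP[/eqP <-//|ct].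
have [z cz Sz] := extend c (ltW sc) ct (fun=> Psc).
by have := ub_le_sup Sub Sz; rewrite leNgt cz.
Qed.

End segment_induction.

Section chains.
Context {R : realType}.
Implicit Types (f : R -> R) (s x y : R) (p q : seq R).

Lemma incr_prod_nil f s : incr_prod f s [::] = 1.
Proof. by rewrite /incr_prod /= big_geq. Qed.

Lemma incr_prod_cons f s x p :
  incr_prod f s (x :: p) = (1 + (f x - f s)) * incr_prod f x p.
Proof.
rewrite /incr_prod /= big_nat_recl//=; congr (_ * _).
apply: eq_big_nat => i /andP[_ ip].
by rewrite (set_nth_default x s) ?(set_nth_default x s (s := _ :: _))//= ltnW.
Qed.

Lemma incr_prod_cat f s p q :
  incr_prod f s (p ++ q) = incr_prod f s p * incr_prod f (last s p) q.
Proof.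
elim: p s => [|x p ih] s /=; first by rewrite incr_prod_nil mul1r.
by rewrite !incr_prod_cons ih mulrA.
Qed.

Lemma square_sum_nil f s : square_sum f s [::] = 0.
Proof. by rewrite /square_sum /= big_geq. Qed.

Lemma square_sum_cons f s x p :
  square_sum f s (x :: p) = (f x - f s) ^+ 2 + square_sum f x p.
Proof.
rewrite /square_sum /= big_nat_recl//=; congr (_ + _).
apply: eq_big_nat => i /andP[_ ip].
by rewrite (set_nth_default x s) ?(set_nth_default x s (s := _ :: _))//= ltnW.
Qed.

Lemma square_sum_cat f s p q :
  square_sum f s (p ++ q) = square_sum f s p + square_sum f (last s p) q.
Proof.
elim: p s => [|x p ih] s /=; first by rewrite square_sum_nil add0r.
by rewrite !square_sum_cons ih addrA.
Qed.

Lemma square_sum_ge0 f s p : 0 <= square_sum f s p.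
Proof. by apply: sumr_ge0 => i _; rewrite sqr_ge0. Qed.

Lemma incr_prod_bounds f s p (eta : R) : eta <= 2^-1 ->
  {in s :: p &, forall y z, `|f y - f z| <= eta} ->
  let Q := square_sum f s p in let D := f (last s p) - f s in
  expR (D - 2^-1 * Q - eta * Q) <= incr_prod f s p
    <= expR (D - 2^-1 * Q + eta * Q).
Proof.
move=> e2; elim: p s => [|x p ih] s hp /=.
  by rewrite square_sum_nil incr_prod_nil subrr !mulr0 !subr0 addr0 expR0 lexx.
have /andP[x1 x2] : expR (f x - f s - 2^-1 * (f x - f s) ^+ 2 -
    eta * (f x - f s) ^+ 2) <= 1 + (f x - f s)
    <= expR (f x - f s - 2^-1 * (f x - f s) ^+ 2 + eta * (f x - f s) ^+ 2).
  by apply: expR_quad_bounds => //; apply: hp; rewrite !inE eqxx ?orbT.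
have /ih/andP[p1 p2] : {in x :: p &, forall y z, `|f y - f z| <= eta}.
  by move=> y z yp zp; apply: hp; rewrite inE ?yp ?zp orbT.
rewrite incr_prod_cons square_sum_cons; apply/andP; split.
  apply: le_trans (ler_pM _ _ x1 p1); rewrite ?expR_ge0//.
  by rewrite -expRD ler_expR; lra.
apply: le_trans (ler_pM _ _ x2 p2) _.
- by rewrite (le_trans _ x1) ?expR_ge0.
- by rewrite (le_trans _ p1) ?expR_ge0.
by rewrite -expRD ler_expR; lra.
Qed.

End chains.

(** * Nested partitions *)

Section partitions.
Context {R : realType} (a b : R) (lam : nat -> seq R).
Hypothesis hlam : nested_partitions a b lam.
Implicit Types (s t x y z : R) (m : nat).

Definition inner m s t := [seq x <- lam m | s < x < t].
(** With these defaults the first interior point is always strictly greater than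
    s and the last one strictly less than t, so that one-sided limits apply to
    them without a side condition. *)
Definition first_pt m s t := head t (inner m s t).
Definition last_pt m s t := last s (inner m s t).

Lemma mem_inner m s t x : x \in inner m s t = (s < x < t) && (x \in lam m).
Proof. by rewrite mem_filter. Qed.

Lemma lam_sorted m : sorted <%R (lam m).
Proof. by case: hlam => /(_ m)[/path_sorted]. Qed.

Lemma inner_sorted m s t : sorted <%R (inner m s t).
Proof. by apply: sorted_filter (lam_sorted m); exact: lt_trans. Qed.

Lemma lam_nested m m' x : (m <= m')%N -> x \in a :: lam m -> x \in a :: lam m'.
Proof.
case: hlam => _ nest _ /subnKC <-; elim: (m' - m)%N => [|k ih]; first by rewrite addn0.
by rewrite addnS => /ih; exact: nest.
Qed.

(** Density and nestedness: every open interval eventually contains a partition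
    point, so the extreme interior points below converge to the end points. *)
Lemma near_mem_inner s t : a <= s -> s < t -> t <= b ->
  \forall m \near \oo, exists x, x \in inner m s t.
Proof.
move=> as_ st tb; case: hlam => _ _ dense.
have mid : s < (s + t) / 2 < t by rewrite !midf_lt.
have /dense /(_ `]s, t[%classic) : [set` `[a, b]] ((s + t) / 2).
  case/andP: mid => h1 h2 /=; rewrite in_itv /=.
  by rewrite (le_trans as_ (ltW h1)) (le_trans (ltW h2) tb).
move=> /(_ _)[|x [[M _ xM] /=]].
  by apply: open_nbhs_nbhs; split; [exact: interval_open|rewrite /= in_itv].
rewrite in_itv /= => sxt; exists M => // m /= Mm; exists x.
rewrite mem_inner sxt /=; have := lam_nested Mm xM.
by rewrite inE gt_eqF// (le_lt_trans as_)//; case/andP: sxt.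
Qed.

Lemma first_pt_gt m s t : s < t -> s < first_pt m s t.
Proof.
move=> st; rewrite /first_pt; case E : (inner m s t) => [//|x l] /=.
have : x \in inner m s t by rewrite E mem_head.
by rewrite mem_inner => /andP[/andP[]].
Qed.

Lemma last_pt_lt m s t : s < t -> last_pt m s t < t.
Proof.
move=> st; rewrite /last_pt; case E : (inner m s t) => [//|x l].
have : last s (x :: l) \in inner m s t by rewrite E /= mem_last.
by rewrite mem_inner => /andP[/andP[]].
Qed.

Lemma first_pt_le m s t x : x \in inner m s t -> first_pt m s t <= x.
Proof.
rewrite /first_pt; have := inner_sorted m s t.
case: (inner m s t) => [//|y l]; rewrite /= inE => pl /orP[/eqP->//|xl].
by move: pl; rewrite lt_path_sortedE => /andP[/allP /(_ _ xl) /ltW].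
Qed.

Lemma last_pt_ge m s t x : x \in inner m s t -> x <= last_pt m s t.
Proof.
rewrite /last_pt; have := inner_sorted m s t.
case/lastP: (inner m s t) => [//|l y]; rewrite last_rcons.
rewrite mem_rcons inE => srt /orP[/eqP->//|xl].
move: srt; rewrite lt_sorted_pairwise -cats1 pairwise_cat.
by move=> /and3P[/allrelP/(_ _ _ xl (mem_head _ _))/ltW].
Qed.

Lemma first_pt_cvg s t : a <= s -> s < t -> t <= b ->
  first_pt m s t @[m --> \oo] --> s.
Proof.
move=> as_ st tb; apply/cvgrPdist_le => /= e e0.
have se : s < Num.min t (s + e) by rewrite lt_min st ltrDl.
have : Num.min t (s + e) <= b by rewrite ge_min tb.
move=> /(near_mem_inner as_ se); apply: filterS => m [x].
rewrite mem_inner lt_min => /andP[/and3P[sx xt xe] xm].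
have /first_pt_le fx : x \in inner m s t by rewrite mem_inner sx xt.
rewrite distrC gtr0_norm ?subr_gt0 ?first_pt_gt//.
by rewrite lerBlDl (le_trans fx)// ltW.
Qed.

Lemma last_pt_cvg s t : a <= s -> s < t -> t <= b ->
  last_pt m s t @[m --> \oo] --> t.
Proof.
move=> as_ st tb; apply/cvgrPdist_le => /= e e0.
have se : Num.max s (t - e) < t by rewrite gt_max st gtrBl.
have : a <= Num.max s (t - e) by rewrite le_max as_.
move=> /near_mem_inner/(_ se tb); apply: filterS => m [x].
rewrite mem_inner gt_max => /andP[/andP[/andP[sx ex] xt] xm].
have /last_pt_ge fx : x \in inner m s t by rewrite mem_inner sx xt.
rewrite gtr0_norm ?subr_gt0 ?last_pt_lt//.
by rewrite lerBlDl -lerBlDr (le_trans _ fx)// ltW.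
Qed.

Section along.
Variable F : R -> R.
Hypothesis regF : regulated a b F.

Lemma cvg_first_pt s t : a <= s -> s < t -> t <= b ->
  F (first_pt m s t) @[m --> \oo] --> rlim F s.
Proof.
move=> as_ st tb.
have /cvg_at_rightP : F x @[x --> s^'+] --> rlim F s.
  by apply: cvg_to_rlim regF _; rewrite as_ (lt_le_trans st).
by apply; split; [move=> n; exact: first_pt_gt|exact: first_pt_cvg].
Qed.

Lemma cvg_last_pt s t : a <= s -> s < t -> t <= b ->
  F (last_pt m s t) @[m --> \oo] --> llim F t.
Proof.
move=> as_ st tb.
have /cvg_at_leftP : F x @[x --> t^'-] --> llim F t.
  by apply: cvg_to_llim regF _; rewrite tb (le_lt_trans as_ st).
by apply; split; [move=> n; exact: last_pt_lt|exact: last_pt_cvg].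
Qed.

End along.

Lemma inner_lt m s t y : y <= t -> [seq x <- inner m s t | x < y] = inner m s y.
Proof.
move=> yt; rewrite -filter_predI; apply: eq_filter => x /=.
by case: (ltP x y) => xy; rewrite ?andbF//= (lt_le_trans xy yt).
Qed.

Lemma inner_gt m s t y : s <= y -> [seq x <- inner m s t | y < x] = inner m y t.
Proof.
move=> sy; rewrite -filter_predI; apply: eq_filter => x /=.
by case: (ltP y x) => yx //=; rewrite (le_lt_trans sy yx).
Qed.

Lemma inner_cat m s t y : s < y -> y < t ->
  inner m s t = if y \in lam m then rcons (inner m s y) y ++ inner m y t
                else inner m s y ++ inner m y t.
Proof.
move=> sy yt; rewrite -[in RHS](inner_lt _ _ (ltW yt)) -(inner_gt _ _ (ltW sy)).
case: ifP => ym.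
  by apply: in_itv_partition (inner_sorted m s t) _; rewrite mem_inner sy yt.
apply: notin_itv_partition (inner_sorted m s t) _.
by rewrite mem_inner ym andbF.
Qed.

Variable f : R -> R.

Definition partition_prod m s t := incr_prod f s (partition_restr (lam m) s t).

Lemma partition_prodE m s t : partition_prod m s t =
  incr_prod f s (inner m s t) * (1 + (f t - f (last_pt m s t))).
Proof.
rewrite /partition_prod /partition_restr -cats1 incr_prod_cat.
by rewrite incr_prod_cons incr_prod_nil mulr1.
Qed.

Lemma partition_prod_cat_mem m s t y : s < y -> y < t -> y \in lam m ->
  partition_prod m s t = partition_prod m s y * partition_prod m y t.
Proof.
move=> sy yt ym; rewrite /partition_prod /partition_restr -!/(inner _ _ _).
by rewrite (inner_cat m sy yt) ym rcons_cat incr_prod_cat last_rcons.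
Qed.

(** Inserting a point y in a partition replaces one factor by two. *)
Lemma partition_prod_cat_notin m s t y : s < y -> y < t -> y \notin lam m ->
  partition_prod m s t * ((1 + (f y - f (last_pt m s y))) *
                     (1 + (f (first_pt m y t) - f y))) =
  partition_prod m s y * partition_prod m y t *
    (1 + (f (first_pt m y t) - f (last_pt m s y))).
Proof.
move=> sy yt ym; rewrite (partition_prodE m s y) /partition_prod /partition_restr.
rewrite -!/(inner _ _ _) (inner_cat m sy yt) (negbTE ym) rcons_cat.
rewrite incr_prod_cat.
have -> : rcons (inner m y t) t =
    first_pt m y t :: behead (rcons (inner m y t) t).
  by rewrite /first_pt; case: (inner m y t).
by rewrite !incr_prod_cons -/(last_pt m s y); ring.
Qed.

Hypothesis regf : regulated a b f.
Hypothesis hjumps : [set t | a < t < b /\ ljump f t * rjump f t <> 0]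
                `<=` \bigcup_m [set` a :: lam m].
Hypothesis jump_neqN1 : forall side x, in_ext a b (gap_lo side x) ->
  in_ext a b (gap_hi side x) -> jump side f x != -1.

(** Splitting at y is exact once y belongs to the partitions. Otherwise one
    factor is replaced by two, and in the limit this changes 1 + j + k into
    (1 + j) * (1 + k), where j and k are the jumps of f at y: the two agree as
    y has no two-sided jump. This is where the hypothesis on two-sided jumps
    enters. *)
Lemma partition_prod_cat s t y : a <= s -> s < y -> y < t -> t <= b ->
  exists2 k : nat -> R, k m @[m --> \oo] --> (1 : R) &
   \forall m \near \oo,
     partition_prod m s t = partition_prod m s y * partition_prod m y t * k m.
Proof.
move=> as_ sy yt tb.
have ay : a < y by exact: le_lt_trans sy.
have yb : y < b by exact: lt_le_trans tb.
have [[M _ yM]|yn] := pselect ((\bigcup_m [set` a :: lam m]) y).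
  exists (fun=> 1); first exact: cvg_cst.
  exists M => // m /= Mm; rewrite mulr1 (@partition_prod_cat_mem m s t y)//.
  by have := lam_nested Mm yM; rewrite inE gt_eqF.
have yn' m : y \notin lam m.
  by apply/negP => ym; apply: yn; exists m => //=; rewrite inE ym orbT.
have jj : ljump f y * rjump f y = 0.
  by apply: contrapT => jj; apply: yn; apply: hjumps; split=> //; rewrite ay.
have /eqP l1 : ljump f y != -1.
  by apply: (@jump_neqN1 false y); rewrite /= ?ay ?(ltW ay) ltW.
have /eqP r1 : rjump f y != -1.
  by apply: (@jump_neqN1 true y); rewrite /= ?yb ?(ltW ay) ?ltW.
have cl := cvg_last_pt regf as_ sy (ltW yb).
have cr := cvg_first_pt regf (ltW ay) yt tb.
have cL : 1 + (f y - f (last_pt m s y)) @[m --> \oo] --> 1 + ljump f y.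
  by apply: cvgD; [exact: cvg_cst|apply: cvgB => //; exact: cvg_cst].
have cR : 1 + (f (first_pt m y t) - f y) @[m --> \oo] --> 1 + rjump f y.
  by apply: cvgD; [exact: cvg_cst|apply: cvgB => //; exact: cvg_cst].
have D0 : (1 + ljump f y) * (1 + rjump f y) != 0.
  apply: mulf_neq0; rewrite addrC addr_eq0; exact/eqP.
exists (fun m => (1 + (f (first_pt m y t) - f (last_pt m s y))) /
  ((1 + (f y - f (last_pt m s y))) * (1 + (f (first_pt m y t) - f y)))).
  have E : (1 + (rlim f y - llim f y)) * ((1 + ljump f y) * (1 + rjump f y))^-1
      = 1.
    rewrite (_ : 1 + (rlim f y - llim f y) =
      (1 + ljump f y) * (1 + rjump f y)) ?divff//.
    transitivity (1 + (ljump f y + rjump f y) + ljump f y * rjump f y).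
      by rewrite jj /ljump /rjump; ring.
    ring.
  have := cvgM (cvgD (cvg_cst (1 : R)) (cvgB cr cl)) (cvgV D0 (cvgM cL cR)).
  by rewrite E; apply.
have : \forall m \near \oo, (1 + (f y - f (last_pt m s y))) *
    (1 + (f (first_pt m y t) - f y)) != 0.
  by apply: cvgr_neq0 D0; exact: (cvgM cL cR).
apply: filterS => m Dm.
by rewrite mulrA -partition_prod_cat_notin// mulfK.
Qed.

End partitions.

(** * Convergence of the partition products *)

Lemma expR_boundsM {R : realType} (p q x y : R) :
  expR (- p) <= x <= expR p -> expR (- q) <= y <= expR q ->
  expR (- (p + q)) <= x * y <= expR (p + q).
Proof.
move=> /andP[x1 x2] /andP[y1 y2]; rewrite opprD !expRD.
by rewrite !ler_pM ?expR_ge0// ?(le_trans _ x1) ?(le_trans _ y1) ?expR_ge0.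
Qed.

(** Besides not vanishing, G only has to have the right jumps and the right local
    expansion: its construction as an infinite product no longer matters. *)
Section product_limit.
Context {R : realType} (a b : R) (lam : nat -> seq R) (f V G : R -> R).
Hypothesis hlam : nested_partitions a b lam.
Hypothesis regf : regulated a b f.
Hypothesis regV : regulated a b V.
Hypothesis V_le : forall x y, a <= x -> x < y -> y <= b -> V x <= V y.
Hypothesis jumpV : forall side x, in_ext a b (gap_lo side x) ->
  in_ext a b (gap_hi side x) -> jump side V x = jump side f x ^+ 2.
Hypothesis jump_neqN1 : forall side x, in_ext a b (gap_lo side x) ->
  in_ext a b (gap_hi side x) -> jump side f x != -1.
Hypothesis hjumps : [set t | a < t < b /\ ljump f t * rjump f t <> 0]
                `<=` \bigcup_m [set` a :: lam m].
Hypothesis sumV : forall s t, a <= s -> s < t -> t <= b ->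
  square_sum f s (partition_restr (lam m) s t) @[m --> \oo] --> V t - V s.
Hypothesis regG : regulated a b G.
Hypothesis G_neq0 : forall x, a <= x <= b -> G x != 0.
Hypothesis G_rlim : forall x, a <= x < b -> rlim G x = G x * (1 + rjump f x).
Hypothesis G_llim : forall x, a < x <= b -> G x = llim G x * (1 + ljump f x).
Hypothesis G_bounds : forall x y (eta : R), a <= x -> x <= y -> y <= b ->
  0 <= eta -> eta <= 4^-1 ->
  (forall side z, gaps a b side (Pt x) (Pt y) z -> `|jump side f z| <= eta) ->
  expR (f y - f x - 2^-1 * (V y - V x) - 2 * eta * (V y - V x)) <= G y / G x
    <= expR (f y - f x - 2^-1 * (V y - V x) + 2 * eta * (V y - V x)).
Implicit Types (s t x y z c e eta : R) (m : nat).

Local Notation partition_prod := (partition_prod lam f).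
Local Notation first_pt := (first_pt lam).
Local Notation last_pt := (last_pt lam).
Local Notation inner := (inner lam).

Let ratio m s t := partition_prod m s t / (G t / G s).

(** An asymptotic error bound on the logarithmic scale, where concatenation of
    intervals adds the errors. *)
Definition agree c s t := forall e, 0 < e ->
  \forall m \near \oo, expR (- (c + e)) <= ratio m s t <= expR (c + e).

Lemma agree_cat c c' s y t : a <= s -> s < y -> y < t -> t <= b ->
  agree c s y -> agree c' y t -> agree (c + c') s t.
Proof.
move=> as_ sy yt tb g1 g2 e e0.
have [k k1 kE] := partition_prod_cat hlam regf hjumps jump_neqN1 as_ sy yt tb.
have e3 : 0 < e / 3 by rewrite divr_gt0.
have /cvg1P/(_ _ e3) hk := k1.
near=> m.
have Em : partition_prod m s t = partition_prod m s y * partition_prod m y t * k m by near: m.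
have -> : ratio m s t = ratio m s y * ratio m y t * k m.
  have st := lt_trans sy yt.
  have Gs : G s != 0 by rewrite G_neq0// as_ (le_trans (ltW st)).
  have Gy : G y != 0 by rewrite G_neq0// (le_trans as_ (ltW sy)) (le_trans (ltW yt)).
  have Gt : G t != 0 by rewrite G_neq0// tb (le_trans as_ (ltW st)).
  by rewrite /ratio Em; field; rewrite Gs Gy Gt.
have -> : c + c' + e = (c + e / 3) + (c' + e / 3) + e / 3 by lra.
apply: expR_boundsM; last by near: m.
by apply: expR_boundsM; near: m; [exact: g1|exact: g2].
Unshelve. all: by end_near. Qed.

(** The factors of the two extreme cells of [x, t] may contain a big jump at x
    or t; they are handled exactly, by the jumps of G. *)
Lemma first_factor_cvg x t : a <= x -> x < t -> t <= b ->
  (1 + (f (first_pt m x t) - f x)) / (G (first_pt m x t) / G x)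
    @[m --> \oo] --> (1 : R).
Proof.
move=> ax xt tb; have xb := lt_le_trans xt tb.
have xab : a <= x < b by rewrite ax.
have j0 : 1 + rjump f x != 0.
  by rewrite addrC addr_eq0; apply: (@jump_neqN1 true x); rewrite /= ax ?ltW.
have Gx0 : G x != 0 by rewrite G_neq0// ax ltW.
have cG : G (first_pt m x t) / G x @[m --> \oo] --> 1 + rjump f x.
  have -> : 1 + rjump f x = rlim G x / G x by rewrite G_rlim// mulrAC divff ?mul1r.
  by apply: cvgM; [exact: (cvg_first_pt hlam regG ax xt tb)|exact: cvg_cst].
have cf : 1 + (f (first_pt m x t) - f x) @[m --> \oo] --> 1 + rjump f x.
  by apply: cvgD; [exact: cvg_cst|apply: cvgB;
    [exact: (cvg_first_pt hlam regf ax xt tb)|exact: cvg_cst]].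
rewrite -[X in _ --> X](divff j0); exact: (cvgM cf (cvgV j0 cG)).
Qed.

Lemma last_factor_cvg x t : a <= x -> x < t -> t <= b ->
  (1 + (f t - f (last_pt m x t))) / (G t / G (last_pt m x t))
    @[m --> \oo] --> (1 : R).
Proof.
move=> ax xt tb; have at' := le_lt_trans ax xt.
have tab : a < t <= b by rewrite at'.
have j0 : 1 + ljump f t != 0.
  by rewrite addrC addr_eq0; apply: (@jump_neqN1 false t);
    rewrite /= tb ?at' ?(ltW at').
have Gl0 : llim G t != 0.
  have : G t != 0 by rewrite G_neq0// tb ltW.
  by rewrite G_llim// mulf_eq0 negb_or => /andP[].
have cG : G t / G (last_pt m x t) @[m --> \oo] --> 1 + ljump f t.
  have -> : 1 + ljump f t = G t / llim G t.
    by rewrite [in RHS]G_llim// mulrAC divff// mul1r.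
  apply: cvgM; first exact: cvg_cst.
  by apply: cvgV => //; exact: (cvg_last_pt hlam regG ax xt tb).
have cf : 1 + (f t - f (last_pt m x t)) @[m --> \oo] --> 1 + ljump f t.
  by apply: cvgD; [exact: cvg_cst|apply: cvgB;
    [exact: cvg_cst|exact: (cvg_last_pt hlam regf ax xt tb)]].
rewrite -[X in _ --> X](divff j0); exact: (cvgM cf (cvgV j0 cG)).
Qed.

(** The discrepancy between the variation and the square sum over the interior
    cells: it vanishes since both the total and the extreme terms converge to
    their counterparts for V. *)
Lemma inner_var_cvg x t : a <= x -> x < t -> t <= b ->
  (V t - V x - square_sum f x (partition_restr (lam m) x t))
  - (V (first_pt m x t) - V x - (f (first_pt m x t) - f x) ^+ 2)
  - (V t - V (last_pt m x t) - (f t - f (last_pt m x t)) ^+ 2)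
  @[m --> \oo] --> (0 : R).
Proof.
move=> ax xt tb.
have jr : rjump V x = rjump f x ^+ 2.
  by apply: (@jumpV true x); rewrite /= ax ?ltW// (lt_le_trans xt).
have jl : ljump V t = ljump f t ^+ 2.
  by apply: (@jumpV false t); rewrite /= tb ?ltW// (le_lt_trans ax).
have vr := cvg_first_pt hlam regV ax xt tb.
have vl := cvg_last_pt hlam regV ax xt tb.
have fr := cvg_first_pt hlam regf ax xt tb.
have fl := cvg_last_pt hlam regf ax xt tb.
have c1 (c : R) : c @[_ --> \oo] --> c by exact: cvg_cst.
have d1 : f (first_pt m x t) - f x @[m --> \oo] --> rjump f x.
  exact: (cvgB fr (c1 (f x))).
have d2 : f t - f (last_pt m x t) @[m --> \oo] --> ljump f t.
  exact: (cvgB (c1 (f t)) fl).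
rewrite [X in _ --> X](_ : 0 = (V t - V x - (V t - V x)) -
    (rlim V x - V x - rjump f x * rjump f x) -
    (V t - llim V t - ljump f t * ljump f t)); last first.
  by rewrite -!expr2 -jr -jl /rjump /ljump !subrr ?subr0.
have d1s : (f (first_pt m x t) - f x) ^+ 2 @[m --> \oo] --> rjump f x * rjump f x.
  exact: (cvgM d1 d1).
have d2s : (f t - f (last_pt m x t)) ^+ 2 @[m --> \oo] --> ljump f t * ljump f t.
  exact: (cvgM d2 d2).
apply: cvgB; last by apply: cvgB => //; exact: (cvgB (c1 (V t)) vl).
apply: cvgB; first exact: (cvgB (c1 (V t - V x)) (sumV ax xt tb)).
by apply: cvgB => //; exact: (cvgB vr (c1 (V x))).
Qed.

Lemma small_jump x t eta x1 l side z :
  (forall y z, x < y < t -> x < z < t -> `|f y - f z| <= eta) ->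
  a <= x -> t <= b -> x < x1 -> l < t ->
  gaps a b side (Pt x1) (Pt l) z -> `|jump side f z| <= eta.
Proof.
move=> osc ax tb xx1 lt_ /and4P[i1 i2].
case: side i1 i2 => /= i1 i2; rewrite /ext_le /= ?andbT ?andbF ?orbF.
- rewrite orbC -le_eqVlt => x1z zl.
  have /andP[xz zt] : x < z < t by rewrite (lt_le_trans xx1) ?(lt_trans zl).
  have cn : `|f y - f z| @[y --> z^'+] --> `|rlim f z - f z|.
    by apply: cvg_norm; apply: cvgB; [exact: cvg_to_rlim regf i2|exact: cvg_cst].
  apply: (cvgr_to_le cn).
  near=> y; apply: osc; rewrite ?xz//.
  have zy : z < y by near: y; exact: nbhs_right_gt.
  have yt : y < t by near: y; exact: nbhs_right_lt.
  by rewrite yt (lt_trans _ zy)//.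
- move=> x1z; rewrite orbC -le_eqVlt => zl.
  have /andP[xz zt] : x < z < t by rewrite (lt_trans xx1) ?(le_lt_trans zl).
  have cn : `|f z - f y| @[y --> z^'-] --> `|f z - llim f z|.
    by apply: cvg_norm; apply: cvgB; [exact: cvg_cst|exact: cvg_to_llim regf i1].
  apply: (cvgr_to_le cn).
  near=> y; apply: osc; rewrite ?xz//.
  have yz : y < z by near: y; exact: nbhs_left_lt.
  have xy : x < y by near: y; exact: nbhs_left_gt.
  by rewrite xy (lt_trans yz)//.
Unshelve. all: by end_near. Qed.

(** On an interval whose interior carries only small oscillation, peel off the
    two extreme cells; on the remaining ones both the product and G have the
    same second-order expansion, with errors of order eta times the
    variation. *)
Lemma agree_small_osc x t eta : a <= x -> x < t -> t <= b ->
  0 <= eta -> eta <= 4^-1 ->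
  (forall y z, x < y < t -> x < z < t -> `|f y - f z| <= eta) ->
  agree (3 * eta * (V t - V x)) x t.
Proof.
move=> ax xt tb e0 e4 osc e e_gt0.
have e2 : eta <= 2^-1 by lra.
have d0 : 0 < e / 4 by rewrite divr_gt0.
have /cvg1P/(_ _ d0) hA := first_factor_cvg ax xt tb.
have /cvg1P/(_ _ d0) hC := last_factor_cvg ax xt tb.
have /cvgr0Pnorm_le/(_ _ d0) hV := inner_var_cvg ax xt tb.
near=> m.
have [y yI] : exists y, y \in inner m x t
  by near: m; exact: (near_mem_inner hlam ax xt tb).
have : `|V t - V x - square_sum f x (partition_restr (lam m) x t)
  - (V (first_pt m x t) - V x - (f (first_pt m x t) - f x) ^+ 2)
  - (V t - V (last_pt m x t) - (f t - f (last_pt m x t)) ^+ 2)| <= e / 4.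
  by near: m.
have : expR (- (e / 4)) <= (1 + (f (first_pt m x t) - f x)) /
    (G (first_pt m x t) / G x) <= expR (e / 4) by near: m.
have : expR (- (e / 4)) <= (1 + (f t - f (last_pt m x t))) /
    (G t / G (last_pt m x t)) <= expR (e / 4) by near: m.
have : {in inner m x t, forall z, x < z < t}.
  by move=> z; rewrite mem_inner => /andP[].
have : first_pt m x t <= last_pt m x t.
  exact: le_trans (first_pt_le hlam yI) (last_pt_ge hlam yI).
rewrite /ratio partition_prodE /partition_restr -/(inner m x t).
rewrite /first_pt /last_pt; case: (inner m x t) yI => [//|x1 p] _ /=.
set l := last x1 p => x1l inn.
have /andP[xx1 x1t] := inn x1 (mem_head _ _).
have /andP[xl lt_] : x < l < t by apply: inn; rewrite mem_last.
rewrite incr_prod_cons square_sum_cons -cats1 square_sum_cat -/l.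
rewrite square_sum_cons square_sum_nil addr0.
set P := incr_prod f x1 p; set Q := square_sum f x1 p.
set A := (1 + (f x1 - f x)); set C := (1 + (f t - f l)).
move=> /andP[C1 C2] /andP[A1 A2]; rewrite ler_norml => /andP[W1 W2].
have /andP[P1 P2] : expR (f l - f x1 - 2^-1 * Q - eta * Q) <= P
    <= expR (f l - f x1 - 2^-1 * Q + eta * Q).
  by apply: incr_prod_bounds => // z z' /inn hz /inn hz'; exact: osc.
have ax1 : a <= x1 by rewrite (le_trans ax)// ltW.
have lb : l <= b by rewrite (le_trans (ltW lt_)).
have gap_small side z : gaps a b side (Pt x1) (Pt l) z -> `|jump side f z| <= eta.
  by apply: (small_jump osc).
have /andP[B1 B2] := G_bounds ax1 x1l lb e0 e4 gap_small.
have Vxx1 : V x <= V x1 by apply: V_le => //; rewrite ltW// (lt_le_trans x1t).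
have Vlt : V l <= V t by apply: V_le => //; rewrite (le_trans ax)// ltW.
have Q0 : 0 <= Q by exact: square_sum_ge0.
have E0 : 0 < G l / G x1 by apply: lt_le_trans B1; rewrite expR_gt0.
have mid : expR (- (3 * eta * (V t - V x) + e / 4 + e / 4)) <= P / (G l / G x1)
    <= expR (3 * eta * (V t - V x) + e / 4 + e / 4).
  have h1 : 0 <= eta * (V x1 - V x) by rewrite mulr_ge0// subr_ge0.
  have h2 : 0 <= eta * (V t - V l) by rewrite mulr_ge0// subr_ge0.
  have W1' : - (e / 4) <= V l - V x1 - Q by lra.
  have W2' : V l - V x1 - Q <= e / 4 by lra.
  have h3 : 0 <= eta * (e / 4 - (V l - V x1 - Q)) by rewrite mulr_ge0// subr_ge0.
  have h4 : 0 <= eta * (V l - V x1 - Q + e / 4).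
    by rewrite mulr_ge0// -lerBlDr sub0r.
  have h5 : eta * e <= 4^-1 * e by rewrite ler_wpM2r// ltW.
  rewrite ler_pdivlMr// ler_pdivrMr//; apply/andP; split.
    apply: le_trans P1; apply: (le_trans (ler_wpM2l (expR_ge0 _) B2)).
    rewrite -expRD ler_expR; lra.
  apply: (le_trans P2); apply: le_trans (ler_wpM2l (expR_ge0 _) B1).
  rewrite -expRD ler_expR; lra.
have -> : 3 * eta * (V t - V x) + e =
  e / 4 + (3 * eta * (V t - V x) + e / 4 + e / 4) + e / 4 by lra.
have Gx1 : G x1 != 0 by rewrite G_neq0// ax1 (le_trans x1l).
have Gl : G l != 0 by rewrite G_neq0// lb (le_trans ax1).
rewrite [X in _ <= X <= _](_ : _ = A / (G x1 / G x) * (P / (G l / G x1)) *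
    (C / (G t / G l))).
  apply: expR_boundsM; last by rewrite C1.
  by apply: expR_boundsM => //; rewrite A1.
have Gx : G x != 0 by rewrite G_neq0// ax (le_trans (ltW xt)).
have Gt : G t != 0 by rewrite G_neq0// tb (le_trans ax (ltW xt)).
by field; rewrite Gx1 Gl Gx Gt.
Unshelve. all: by end_near. Qed.

(** By regularity of f, the oscillation is at most eta on a one-sided
    neighbourhood of each point; the error bounds add up because the variation
    does. *)
Lemma agree_near eta s t : 0 < eta -> eta <= 4^-1 ->
  a <= s -> s < t -> t <= b -> agree (3 * eta * (V t - V s)) s t.
Proof.
move=> e0 e4 as_ st tb.
have h2 : 0 < eta / 2 by rewrite divr_gt0.
have half (L u v : R) : `|L - u| <= eta / 2 -> `|L - v| <= eta / 2 ->
    `|u - v| <= eta.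
  move=> Lu Lv; apply: (le_trans (ler_distD L u v)).
  by rewrite (distrC u L) (splitr eta) lerD.
apply: (@segment_induction R a b
  (fun s t => agree (3 * eta * (V t - V s)) s t)) => //.
- move=> x y z ax xy yz zb g1 g2.
  have -> : 3 * eta * (V z - V x) = 3 * eta * (V y - V x) + 3 * eta * (V z - V y).
    by ring.
  exact: agree_cat g1 g2.
- move=> x xab; have /andP[ax xb] := xab.
  have /cvgr_dist_le/(_ _ h2)/near_at_right[d xd hd] := cvg_to_rlim regf xab.
  apply/near_at_right; exists (Num.min d b); first by rewrite lt_min xd.
  move=> y; rewrite lt_min => /and3P[xy yd yb].
  apply: agree_small_osc => //; [exact: ltW|exact: ltW|].
  move=> u v /andP[xu uy] /andP[xv vy]; apply: (half (rlim f x)); apply: hd.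
    by rewrite xu (lt_trans uy).
  by rewrite xv (lt_trans vy).
- move=> x xab; have /andP[ax xb] := xab.
  have /cvgr_dist_le/(_ _ h2)/near_at_left[d xd hd] := cvg_to_llim regf xab.
  apply/near_at_left; exists (Num.max d a); first by rewrite gt_max xd.
  move=> y; rewrite gt_max => /andP[/andP[yd ya] yx].
  apply: agree_small_osc => //; [exact: ltW|exact: ltW|].
  move=> u v /andP[xu uy] /andP[xv vy]; apply: (half (llim f x)); apply: hd.
    by rewrite uy (lt_trans yd).
  by rewrite vy (lt_trans yd).
Qed.

Lemma partition_prod_cvg s t : a <= s -> s < t -> t <= b ->
  partition_prod m s t @[m --> \oo] --> G t / G s.
Proof.
move=> as_ st tb.
have r1 : ratio m s t @[m --> \oo] --> (1 : R).
  apply/cvg1P => e e0.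
  have W0 : 0 <= V t - V s by rewrite subr_ge0 V_le.
  pose eta := Num.min 4^-1 (e / (6 * (V t - V s + 1))).
  have k0 : 0 < 6 * (V t - V s + 1) by rewrite mulr_gt0// ltr_wpDl.
  have eta0 : 0 < eta by rewrite lt_min invr_gt0 divr_gt0// andbT.
  have eta4 : eta <= 4^-1 by rewrite ge_min lexx.
  have : eta <= e / (6 * (V t - V s + 1)) by rewrite ge_min lexx orbT.
  rewrite ler_pdivlMr// => etae.
  have e2 : 0 < e / 2 by rewrite divr_gt0.
  have := agree_near eta0 eta4 as_ st tb e2; apply: filterS => m /andP[lo hi].
  have bnd : 3 * eta * (V t - V s) + e / 2 <= e by lra.
  apply/andP; split.
    by apply: le_trans lo; rewrite ler_expR lerN2.
  by apply: le_trans hi _; rewrite ler_expR.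
have Gs : G s != 0 by rewrite G_neq0// as_ (le_trans (ltW st)).
have Gt : G t != 0 by rewrite G_neq0// tb (le_trans as_ (ltW st)).
have GG : G t / G s != 0 by rewrite mulf_neq0// invr_eq0.
rewrite -[X in _ --> X]mul1r.
apply: cvg_trans (cvgM r1 (cvg_cst (G t / G s))).
by apply: near_eq_cvg; apply: nearW => m /=; rewrite /ratio divfK.
Qed.

End product_limit.

(** * The product integral *)

(** Near each point, on either side, G stays away from 0 because the one-sided
    limits do not vanish. *)
Lemma regulated_inf_gt0 (R : realType) (a b : R) (G : R -> R) : a < b ->
  regulated a b G -> (forall u, in_ext a b u -> ext_fun G u != 0) ->
  0 < inf [set `|G x| | x in `[a, b]].
Proof.
move=> hab regG G0.
have [c c0 hc] : exists2 c, 0 < c & forall x, a <= x <= b -> c <= `|G x|.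
  apply: (@segment_induction R a b (fun s t => exists2 c, 0 < c &
    forall x, s <= x <= t -> c <= `|G x|)) => //.
  - move=> x y z _ _ _ _ [c c0 hc] [d d0 hd].
    exists (Num.min c d); first by rewrite lt_min c0.
    move=> w /andP[xw wz]; rewrite ge_min; case: (leP w y) => wy.
      by rewrite hc// xw.
    by rewrite hd ?orbT// (ltW wy).
  - move=> x xab; have /andP[ax xb] := xab.
    have Gx : 0 < `|G x| by rewrite normr_gt0 (G0 (Pt x))//= ax ltW.
    have Gr : 0 < `|rlim G x| by rewrite normr_gt0 (G0 (RPt x)).
    have cG : `|G y| @[y --> x^'+] --> `|rlim G x|.
      by apply: cvg_norm; exact: cvg_to_rlim regG xab.
    have /near_at_right[d xd hd] :
        \forall y \near x^'+, `|rlim G x| / 2 <= `|G y|.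
      by apply: (@cvgr_ge _ _ _ _ _ _ cG); lra.
    apply/near_at_right; exists d => // t /andP[xt td].
    exists (Num.min `|G x| (`|rlim G x| / 2)); first by rewrite lt_min Gx divr_gt0.
    move=> y /andP[]; rewrite le_eqVlt => /orP[/eqP<- _|xy yt].
      by rewrite ge_min lexx.
    by rewrite ge_min (hd y) ?orbT// xy (le_lt_trans yt).
  - move=> x xab; have /andP[ax xb] := xab.
    have Gx : 0 < `|G x| by rewrite normr_gt0 (G0 (Pt x))//= xb ltW.
    have Gr : 0 < `|llim G x| by rewrite normr_gt0 (G0 (LPt x)).
    have cG : `|G y| @[y --> x^'-] --> `|llim G x|.
      by apply: cvg_norm; exact: cvg_to_llim regG xab.
    have /near_at_left[d xd hd] :
        \forall y \near x^'-, `|llim G x| / 2 <= `|G y|.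
      by apply: (@cvgr_ge _ _ _ _ _ _ cG); lra.
    apply/near_at_left; exists d => // t /andP[dt tx].
    exists (Num.min `|G x| (`|llim G x| / 2)); first by rewrite lt_min Gx divr_gt0.
    move=> y /andP[ty]; rewrite le_eqVlt => /orP[/eqP->|yx].
      by rewrite ge_min lexx.
    by rewrite ge_min (hd y) ?orbT// yx (lt_le_trans dt).
apply: lt_le_trans c0 _; apply: lb_le_inf.
  by exists `|G a|, a => //=; rewrite in_itv /= lexx ltW.
by move=> y [x /=]; rewrite in_itv /= => xab <-; exact: hc.
Qed.

Section quad_variation_facts.
Context {R : realType} (a b : R) (lam : nat -> seq R) (f V : R -> R).
Hypothesis qv : is_quad_variation a b lam f V.

Lemma quad_variation_le x y : a <= x -> x < y -> y <= b -> V x <= V y.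
Proof.
case: qv => _ _ q ax xy yb; have [c _ _] := q x y ax xy yb.
rewrite -subr_ge0; apply: (cvgr_to_ge c).
by apply: nearW => m; exact: square_sum_ge0.
Qed.

Lemma quad_variation_jump side x : in_ext a b (gap_lo side x) ->
  in_ext a b (gap_hi side x) -> jump side V x = jump side f x ^+ 2.
Proof.
case: qv => _ _ q; case: side => /= /andP[h1 h2] /andP[h3 h4].
  by have [] := q x b h1 h4 (lexx _).
by have [] := q a x (lexx _) h1 h2.
Qed.

End quad_variation_facts.

Section beta_formula.
Context {R : realType} (a b : R) (lam : nat -> seq R) (f : R -> R).
Hypothesis hab : a < b.
Local Notation V := (quad_variation a b lam f).
Hypothesis qv : is_quad_variation a b lam f V.
Implicit Types u v : ext_point R.

Let regV : regulated a b V. Proof. by case: qv. Qed.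
Let V_le := quad_variation_le qv.
Let jumpV := quad_variation_jump qv.

Let gaps_lE t : a <= t <= b ->
  gaps a b false (Pt a) (Pt t) = `]a, t]%classic.
Proof.
move=> /andP[at' tb]; apply/seteqP; split=> x;
  rewrite /gaps /= in_itv /= /ext_le /=.
  by move=> /and4P[/andP[-> _] _ _]; case: (ltgtP x t).
move=> /andP[ax xt]; rewrite ax (le_trans xt tb) (ltW ax) /=.
by case: (ltgtP x t) xt.
Qed.

Let gaps_rE t : a <= t <= b ->
  gaps a b true (Pt a) (Pt t) = `[a, t[%classic.
Proof.
move=> /andP[at' tb]; apply/seteqP; split=> x;
  rewrite /gaps /= in_itv /= /ext_le /=.
  by move=> /and4P[/andP[-> _] _ _]; case: (ltgtP x t).
move=> /andP[ax xt]; rewrite ax (lt_le_trans xt tb) (ltW (lt_le_trans xt tb)) /=.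
by rewrite xt; case: (ltgtP a x) ax.
Qed.

Let cont_quad_variationE t : a <= t <= b -> cont_quad_variation a b lam f t =
  V t - all_jump_sq a b f (Pt a) (Pt t).
Proof.
move=> tab; rewrite /cont_quad_variation /all_jump_sq /jump_sq.
by rewrite gaps_lE// gaps_rE// opprD addrA.
Qed.

Lemma ext_fun_cont_quad_variation u : in_ext a b u ->
  ext_fun (cont_quad_variation a b lam f) u =
  ext_fun V u - all_jump_sq a b f (Pt a) u.
Proof.
move: u; apply: (@ext_fun_lim _ a b _
  (fun u => ext_fun V u - all_jump_sq a b f (Pt a) u) _ _ _).2 => t tab;
  have /andP[t1 t2] := tab.
- by rewrite cont_quad_variationE.
- apply: cvg_trans (cvgB (cvg_to_llim regV tab)
    (all_jump_sq_llim hab regV V_le jumpV tab)).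
  apply: near_eq_cvg; near=> x; apply: esym; apply: cont_quad_variationE.
  have xt : x < t by near: x; exact: nbhs_left_lt.
  have ax : a < x by near: x; exact: nbhs_left_gt.
  by rewrite !ltW// (lt_le_trans xt)//.
- apply: cvg_trans (cvgB (cvg_to_rlim regV tab)
    (all_jump_sq_rlim hab regV V_le jumpV tab)).
  apply: near_eq_cvg; near=> x; apply: esym; apply: cont_quad_variationE.
  have xt : t < x by near: x; exact: nbhs_right_gt.
  have ax : x < b by near: x; exact: nbhs_right_lt.
  by rewrite !ltW// (le_lt_trans _ xt)//.
Unshelve. all: by end_near. Qed.

Lemma gamma_partialE u v d : gamma_partial a b f u v d =
  jump_prod_gt a b f false u v d * jump_prod_gt a b f true u v d.
Proof.
have ltl x : ext_lt u (Pt x) = ext_le u (LPt x).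
  by rewrite ext_ltNge -(gap_cut false).
have ltr x : ext_lt (Pt x) v = ext_le (RPt x) v.
  by rewrite ext_ltNge -[Pt x]/(gap_lo true x) gap_cut negbK.
rewrite /gamma_partial /jump_prod_gt; congr (_ * _); apply: eq_fsbigl;
  apply/seteqP; split=> x /=; rewrite /big_gaps /gaps /= in_itv /= ?ltl ?ltr.
- move=> /and4P[/andP[ax xb] ux xv dx]; split=> //=.
  by rewrite (ltW ax) ax xb ux.
- by move=> [/and4P[-> _ -> ->] ->].
- move=> /and4P[/andP[ax xb] ux xv dx]; split=> //=.
  by rewrite (ltW xb) ax xb ux.
- by move=> [/and4P[_ -> -> ->] ->].
Qed.

Hypothesis jump_neqN1 : forall side x, in_ext a b (gap_lo side x) ->
  in_ext a b (gap_hi side x) -> jump side f x != -1.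

(** The squares of the jumps are additive, so the continuous part of the
    variation has the increments used in beta_incr. *)
Lemma betaE u v : in_ext a b u -> in_ext a b v -> ext_le u v ->
  beta a b lam f u v = beta_incr a b f V u v.
Proof.
move=> iu iv uv; have ia : in_ext a b (Pt a) by rewrite /= lexx ltW.
have lau : ext_le (Pt a) u.
  move: iu; rewrite /ext_le; case: u {uv} => x /= /andP[ax _]; rewrite ?ax//;
    by rewrite andbT orbC -le_eqVlt.
rewrite /beta /beta_incr; congr (expR _ * _).
  rewrite !ext_fun_cont_quad_variation//.
  rewrite (all_jump_sqD regV V_le jumpV ia iu iv lau uv).
  by rewrite /ext_incr; ring.
rewrite /gamma_prod; case: ifP => [_|].
  have [g1 _] := jump_prod_cvg_neq0 regV V_le jumpV jump_neqN1 false iu iv uv.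
  have [g2 _] := jump_prod_cvg_neq0 regV V_le jumpV jump_neqN1 true iu iv uv.
  apply: cvg_lim => //; apply: cvg_trans (cvgM g1 g2).
  by apply: near_eq_cvg; apply: nearW => d; rewrite gamma_partialE.
rewrite ext_ltNge => /negbFE vu.
by rewrite (ext_le_anti uv vu) !jump_prod0 mulr1.
Qed.

End beta_formula.

Theorem theorem42 (R : realType) (a b : R) (hab : a < b) (f : R -> R)
    (hf : regulated a b f) (lam : nat -> seq R)
    (hlam : nested_partitions a b lam)
    (hqv : has_quad_variation a b lam f)
    (hjumps : [set t | a < t < b /\ ljump f t * rjump f t <> 0]
                `<=` \bigcup_m [set` a :: lam m])
    (hunit : forall x y : R, a <= y -> y < x -> x <= b ->
       ljump f x <> -1 /\ rjump f y <> -1) :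
  prod_integral_defined a b lam f /\
  (forall u v : ext_point R, in_ext a b u -> in_ext a b v -> ext_le u v ->
     prod_integral a b lam f u v = beta a b lam f u v).
Proof.
have qv : is_quad_variation a b lam f (quad_variation a b lam f).
  exact: (xgetPex (fun=> 0) hqv).
set V := quad_variation a b lam f in qv.
have regV : regulated a b V by case: qv.
have V_le := quad_variation_le qv.
have jumpV := quad_variation_jump qv.
have jump_neqN1 side x : in_ext a b (gap_lo side x) ->
    in_ext a b (gap_hi side x) -> jump side f x != -1.
  case: side => /= /andP[h1 h2] /andP[h3 h4]; apply/eqP.
    exact: (hunit b x h1 h4 (lexx _)).2.
  exact: (hunit x a (lexx _) h1 h2).1.
have sumV s t : a <= s -> s < t -> t <= b ->
    square_sum f s (partition_restr (lam m) s t) @[m --> \oo] --> V t - V s.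
  by case: qv => _ _ q as_ st tb; case: (q s t as_ st tb).
pose G := beta_fun a b f V.
have [regG GE] : regulated a b G /\
    forall u, in_ext a b u -> ext_fun G u = beta_incr a b f V (Pt a) u.
  exact: beta_fun_lim.
have ia : in_ext a b (Pt a) by rewrite /= lexx ltW.
have lea u : in_ext a b u -> ext_le (Pt a) u.
  rewrite /ext_le; case: u => x /= /andP[ax _]; rewrite ?ax//;
    by rewrite andbT orbC -le_eqVlt.
have GM u v : in_ext a b u -> in_ext a b v -> ext_le u v ->
    ext_fun G v = ext_fun G u * beta_incr a b f V u v.
  move=> iu iv uv; rewrite !GE//.
  exact: (beta_incrM regV V_le jumpV jump_neqN1 ia iu iv (lea u iu) uv).
have G0 u : in_ext a b u -> ext_fun G u != 0.
  by move=> iu; rewrite GE// (beta_incr_neq0 regV V_le jumpV jump_neqN1)// lea.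
have Gdiv u v : in_ext a b u -> in_ext a b v -> ext_le u v ->
    ext_fun G v / ext_fun G u = beta_incr a b f V u v.
  by move=> iu iv uv; rewrite (GM u v)// mulrAC divff ?mul1r// G0.
have Gjump side x : in_ext a b (gap_lo side x) -> in_ext a b (gap_hi side x) ->
    ext_fun G (gap_hi side x) = ext_fun G (gap_lo side x) * (1 + jump side f x).
  move=> i1 i2; rewrite (GM _ _ i1 i2 (gap_le side x)).
  by rewrite (beta_incr_gap jumpV i1 i2).
have Gcvg s t : a <= s -> s < t -> t <= b ->
    incr_prod f s (partition_restr (lam m) s t) @[m --> \oo] --> G t / G s.
  apply: (partition_prod_cvg hlam hf regV V_le jumpV jump_neqN1 hjumps sumV regG).
  - by move=> x xab; exact: (G0 (Pt x)).
  - by move=> x /andP[ax xb]; apply: (Gjump true x); rewrite /= ax ?(ltW xb).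
  - by move=> x /andP[ax xb]; apply: (Gjump false x); rewrite /= xb ?ax ?(ltW ax).
  - move=> x y eta ax xy yb e0 e4 small.
    have ix : in_ext a b (Pt x) by rewrite /= ax (le_trans xy).
    have iy : in_ext a b (Pt y) by rewrite /= yb (le_trans ax).
    have lxy : ext_le (Pt x) (Pt y) by rewrite /ext_le /= andbT orbC -le_eqVlt.
    rewrite -[G y]/(ext_fun G (Pt y)) -[G x]/(ext_fun G (Pt x)) Gdiv//.
    exact: (beta_incr_bounds regV V_le jumpV jump_neqN1 ix iy lxy e0 e4 small).
have PG : is_prod_integral a b lam f G.
  split=> //; first exact: beta_incrxx.
    exact: regulated_inf_gt0.
  move=> s t as_ st tb; split; first exact: Gcvg.
  - have iL : in_ext a b (LPt t) by rewrite /= tb (le_lt_trans as_).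
    have iP : in_ext a b (Pt t) by rewrite /= tb (le_trans as_ (ltW st)).
    have := Gjump false t iL iP; rewrite /= => ->.
    by rewrite mulrAC divff ?mul1r// (G0 (LPt t)).
  - have iR : in_ext a b (RPt s) by rewrite /= as_ (lt_le_trans st).
    have iP : in_ext a b (Pt s) by rewrite /= as_ (le_trans (ltW st)).
    have := Gjump true s iP iR; rewrite /= => ->.
    by rewrite mulrAC divff ?mul1r// (G0 (Pt s)).
split; first by exists G.
move=> u v iu iv uv; rewrite betaE// -Gdiv//.
rewrite /prod_integral; set G' := xget _ _.
have PG' : is_prod_integral a b lam f G' by apply: (xgetPex (fun=> 1)); exists G.
have GG' t : a <= t <= b -> G' t = G t.
  move=> /andP[]; rewrite le_eqVlt => /orP[/eqP <- _|at' tb].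
    by case: PG' => _ -> _ _; case: PG => _ ->.
  case: PG' => _ G'a _ /(_ a t (lexx _) at' tb)[c' _ _].
  have := Gcvg a t (lexx _) at' tb.
  have -> : G a = 1 by case: PG.
  rewrite G'a !divr1 in c' * => c.
  exact: (cvg_unique _ c' c).
have [_ EG] : regulated a b G' /\
    forall u, in_ext a b u -> ext_fun G' u = ext_fun G u.
  apply: ext_fun_lim => // t tab; have /andP[t1 t2] := tab.
  - apply: cvg_trans (cvg_to_llim regG tab); apply: near_eq_cvg.
    near=> x; apply: esym; apply: GG'.
    have xt : x < t by near: x; exact: nbhs_left_lt.
    have ax : a < x by near: x; exact: nbhs_left_gt.
    by rewrite !ltW// (lt_le_trans xt)//.
  - apply: cvg_trans (cvg_to_rlim regG tab); apply: near_eq_cvg.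
    near=> x; apply: esym; apply: GG'.
    have xt : t < x by near: x; exact: nbhs_right_gt.
    have ax : x < b by near: x; exact: nbhs_right_lt.
    by rewrite !ltW// (le_lt_trans _ xt)//.
by rewrite !EG.
Unshelve. all: by end_near. Qed.
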